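(* Suppose Assumptions 1 and 2 (both stated in the context) hold and $K\ge2$. Let $D=C_{deg}\frac aK$ and $\theta=\chi a$, where the constant $C_{deg}$ is sufficiently large and $\chi>0$ is sufficiently small, depending on $\rho_+$. There exist constants $L,c_1,c_2,c_3>0$ such that if $\varepsilon\ge L\log(nK)$, the output $\widehat\sigma$ of the Main Algorithm described in the context (run on $A$ drawn from the SBM with ground truth $\sigma_0$, with parameters $K,D,\theta,\varepsilon$) satisfies $$\sup_{\sigma_0\in\Sigma}\mathbb E\, r(\sigma_0,\widehat\sigma)\le \exp\left\{-c_1\frac{nI}{K}\right\}+\frac1{nK}e^{-c_2\varepsilon}+(nK)^{-c_3A_0}.$$
   Context: Setting. $n,K$ are positive integers with $K\mid n$, $s=n/K$; $[m]=\{1,\dots,m\}$. Undirected graphs on $[n]$ are identified with symmetric zero-diagonal matrices $A\in\{0,1\}^{n\times n}$; $E(A)$ is the set of unordered edges $ij$. $\Sigma=\{\sigma:[n]\to[K]: |\sigma^{-1}(k)|=s\ \forall k\in[K]\}$. $Y^\sigma_{ij}=\mathbf 1\{\sigma(i)=\sigma(j)\}$ is the cluster matrix of $\sigma\in\Sigma$. $h(\sigma,\tau)=|\{i:\sigma_i\ne\tau_i\}|$. $\mathfrak S_K$ is the group of permutations of $[K]$. The loss is $r(\sigma,\tau)=\frac1n\min_{\pi\in\mathfrak S_K}h(\pi\circ\sigma,\tau)$. $\|\cdot\|_1$ is the entrywise $\ell_1$ norm, $\langle A,B\rangle=\mathrm{Tr}(AB^T)$. SBM with ground truth $\sigma_0\in\Sigma$: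 the upper-triangular entries of $A$ are independent, $\mathbb P(A_{ij}=1)=a/n$ if $\sigma_0(i)=\sigma_0(j)$ and $b/n$ otherwise. The expectation $\mathbb E$ is over this $A$ and the algorithm's randomness. $I$ is the order-$1/2$ Rényi divergence between $\mathrm{Ber}(a/n)$ and $\mathrm{Ber}(b/n)$: $I=-2\log\big(\sqrt{\tfrac an\tfrac bn}+\sqrt{(1-\tfrac an)(1-\tfrac bn)}\big)$. Score. For $D>0$, $Y\in[0,1]^{n\times n}$, let $\widetilde H_{A,D}(Y)=\min_{q,z}\{\sum_{ij\in E(A)}z_{ij}Y_{ij}+D\sum_{i=1}^nq_i\}$ over $0\le q_i\le1$ $(i\in[n])$, $0\le z_{ij}\le1$ and $z_{ij}\ge1-q_i-q_j$ $(ij\in E(A))$. Let $\widetilde\Psi_{A,D}(Y)=\widetilde H_{A,D}(Y)-\lambda\sum_{i<j}Y_{ij}$ and $\widetilde T_{A,D}(\sigma)=\widetilde\Psi_{A,D}(Y^\sigma)$. Here $\lambda$ is the penalty parameter of the penalized likelihood score $T_A(\sigma)=\sum_{i<j}(A_{ij}-\lambda)\mathbf 1\{\sigma(i)=\sigma(j)\}$, chosen as in Klopp and Zadik (2026); the penalty does not depend on $A$, and since $\sum_{i<j}Y_{ij}$ is constant over the set $\mathcal C$ below (which contains all $Y^\sigma$, $\sigma\in\Sigma$), the value of $\lambda$ affects neither $\pi_A$ nor any step of the algorithm. With $\eta=\frac{\varepsilon}{2D}$, the Gibbs law is $\pi_A(\sigma)=\exp\{\eta\widetilde T_{A,D}(\sigma)\}/\sum_{\tau\in\Sigma}\exp\{\eta\widetilde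 T_{A,D}(\tau)\}$, $\sigma\in\Sigma$. Certificate. $\mathcal C=\{Y\in\mathbb R^{n\times n}: Y\succeq0,\ Y_{ii}=1\ \forall i,\ Y_{ij}\ge0\ \forall i,j,\ Y\mathbf 1=s\mathbf 1\}$ and, for a cluster matrix $Z$, $V_\theta(Z)=\max_{Y\in\mathcal C}\{\widetilde\Psi_{A,D}(Y)+\frac\theta n\|Y-Z\|_1\}$. Canonical labelings. For $\sigma,\sigma^\star\in\Sigma$, $\mathrm{Can}_{\sigma^\star}(\sigma)$ is the lexicographically smallest vector among the labelings $\pi\circ\sigma$ with $\pi\in\arg\min_{\pi\in\mathfrak S_K}h(\pi\circ\sigma,\sigma^\star)$, and $R_{\sigma^\star}=\{\sigma\in\Sigma:\mathrm{Can}_{\sigma^\star}(\sigma)=\sigma\}$. Main Algorithm. Input $A$, $K,D,\theta,\varepsilon$, with $\eta=\frac{\varepsilon}{2D}$ and $\kappa=2\eta\theta/K$, so that $\kappa\ge\log(4n(K-1))$. 1. Compute an optimal solution $\widehat X$ of the candidate SDP: $\max_X\langle A,X\rangle$ s.t. $X\succeq0$, $X\mathbf 1\le\mathbf 1$, $\mathrm{Tr}(X)=K$, $X\ge0$ entrywise. 2. If $s\widehat X=Y^{\sigma}$ for some $\sigma\in\Sigma$, let $\sigma^\star$ be such a $\sigma$; otherwise choose an arbitrary $\sigma^\star\in\Sigma$. 3. Check whether $V_\theta(Y^{\sigma^\star})=\widetilde\Psi_{A,D}(Y^{\sigma^\star})$. 4. If yes, run the certified rejection sampler: repeat independent trials: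 propose $\sigma\in[K]^n$ with independent coordinates, $\mathbb P(\sigma_i=\sigma^\star_i)=\frac1{1+(K-1)e^{-\kappa}}$, $\mathbb P(\sigma_i=\ell)=\frac{e^{-\kappa}}{1+(K-1)e^{-\kappa}}$ for $\ell\ne\sigma^\star_i$; reject if $\sigma\notin\Sigma$ or $\sigma\notin R_{\sigma^\star}$; otherwise accept with probability $b_A(\sigma)=\exp\{\eta[\widetilde T_{A,D}(\sigma)-\widetilde T_{A,D}(\sigma^\star)]+\kappa h(\sigma,\sigma^\star)\}$. At the first acceptance, draw $\Pi\sim\mathrm{Unif}(\mathfrak S_K)$ and return $\Pi\circ\sigma$. 5. If no, sample exactly from $\pi_A$ by brute-force enumeration of $\Sigma$. Assumptions. $K,a,b$ may depend on $n$; $o(\cdot)$ refers to $n\to\infty$; constants are absolute positive constants. Assumption 1: there is an absolute constant $C_{\mathrm{mg}}>0$ with $K\log(K)\le C_{\mathrm{mg}}\log(n)$. Assumption 2: there are absolute constants $0<\rho_-\le\rho_+<1$ and $A_0>0$ with $\frac aK\ge A_0\log(nK)$, $a,b=o(n)$, and $0<\rho_-\le b/a\le\rho_+<1$. *)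

(* Defs.v *)
From HB Require Import structures.
From mathcomp Require Export all_boot all_order all_algebra all_fingroup.
From mathcomp Require Export all_classical all_reals all_analysis.

Set Implicit Arguments.
Unset Strict Implicit.
Unset Printing Implicit Defensive.

Export Order.TTheory GRing.Theory Num.Theory numFieldNormedType.Exports.

Local Open Scope classical_set_scope.
Local Open Scope ring_scope.

Definition labeling (n K : nat) : finType := {ffun 'I_n -> 'I_K}.

(* K divides n in all uses, so n %/ K is the common cluster size. *)
Definition balanced (n K : nat) : pred (labeling n K) :=
  fun sigma => [forall k : 'I_K, #|[pred i | sigma i == k]| == (n %/ K)%N].

Definition hamming (n K : nat) (sigma tau : labeling n K) : nat :=
  #|[pred i | sigma i != tau i]|.

Definition relabel (n K : nat) (pi : 'S_K) (sigma : labeling n K) :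
  labeling n K := [ffun i => pi (sigma i)].

(* hamming is at most n, so n is a neutral default for the minimum. *)
Definition loss (R : realType) (n K : nat) (sigma tau : labeling n K) : R :=
  (\big[minn/n]_(pi : 'S_K) hamming (relabel pi sigma) tau)%:R / n%:R.

Definition cluster_mx (R : realType) (n K : nat) (sigma : labeling n K) :
  'M[R]_n := \matrix_(i, j) (sigma i == sigma j)%:R.

(* The vector (sigma(1), ..., sigma(n)) in the lexicographic order. *)
Definition lexvec (n K : nat) (sigma : labeling n K) : seqlexi nat :=
  [seq val (sigma i) | i <- enum 'I_n].

Definition optimal_alignment (n K : nat) (sigma sstar : labeling n K) :
  pred 'S_K :=
  fun pi => [forall pi' : 'S_K,
    hamming (relabel pi sigma) sstar <= hamming (relabel pi' sigma) sstar]%N.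

(* The starting point of the outer [arg min] has to satisfy the constraint;
   it is immaterial for the resulting labeling. *)
Definition canonical (n K : nat) (sstar sigma : labeling n K) : labeling n K :=
  let pi0 :=
    [arg min_(pi < (1%g : 'S_K)) hamming (relabel pi sigma) sstar]%N in
  relabel [arg min_(pi < pi0 | optimal_alignment sigma sstar pi)
             lexvec (relabel pi sigma)]%O sigma.

Definition canonical_reps (n K : nat) (sstar : labeling n K) :
  pred (labeling n K) :=
  fun sigma => balanced sigma && (canonical sstar sigma == sigma).

Definition is_graph (n : nat) : pred 'M[bool]_n :=
  fun A => [forall i, ~~ A i i] && [forall i, forall j, A i j == A j i].

Definition edge_prob (R : realType) (n K : nat) (a b : R)
    (sigma0 : labeling n K) (i j : 'I_n) : R :=
  if sigma0 i == sigma0 j then a / n%:R else b / n%:R.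

(* Probability of the graph A (for A satisfying is_graph). *)
Definition sbm_pmf (R : realType) (n K : nat) (a b : R)
    (sigma0 : labeling n K) (A : 'M[bool]_n) : R :=
  \prod_(i < n) \prod_(j < n | (i < j)%N)
    (if A i j then edge_prob a b sigma0 i j else 1 - edge_prob a b sigma0 i j).

Definition renyi_half (R : realType) (n : nat) (a b : R) : R :=
  - 2 * ln (Num.sqrt (a / n%:R * (b / n%:R)) +
            Num.sqrt ((1 - a / n%:R) * (1 - b / n%:R))).

Definition H_feasible (R : realType) (n : nat) (A : 'M[bool]_n)
    (q : 'I_n -> R) (z : 'M[R]_n) : Prop :=
  (forall i, 0 <= q i <= 1) /\
  (forall i j : 'I_n, (i < j)%N -> A i j ->
     0 <= z i j <= 1 /\ 1 - q i - q j <= z i j).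

Definition H_objective (R : realType) (n : nat) (A : 'M[bool]_n) (D : R)
    (Y : 'M[R]_n) (q : 'I_n -> R) (z : 'M[R]_n) : R :=
  \sum_(i < n) \sum_(j < n | (i < j)%N && A i j) z i j * Y i j +
  D * \sum_(i < n) q i.

(* The minimum of a linear program is attained, hence it is the infimum. *)
Definition H_ext (R : realType) (n : nat) (A : 'M[bool]_n) (D : R)
    (Y : 'M[R]_n) : R :=
  inf [set v | exists q z, H_feasible A q z /\ v = H_objective A D Y q z].

Definition Psi (R : realType) (n : nat) (A : 'M[bool]_n) (D lambda : R)
    (Y : 'M[R]_n) : R :=
  H_ext A D Y - lambda * \sum_(i < n) \sum_(j < n | (i < j)%N) Y i j.

Definition score (R : realType) (n K : nat) (A : 'M[bool]_n) (D lambda : R)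
    (sigma : labeling n K) : R :=
  Psi A D lambda (cluster_mx R sigma).

Definition gibbs (R : realType) (n K : nat) (A : 'M[bool]_n)
    (D lambda eta : R) (sigma : labeling n K) : R :=
  if balanced sigma then
    expR (eta * score A D lambda sigma) /
    \sum_(tau : labeling n K | balanced tau) expR (eta * score A D lambda tau)
  else 0.

Definition psd (R : realType) (n : nat) (X : 'M[R]_n) : Prop :=
  X^T = X /\ forall v : 'rV[R]_n, 0 <= (v *m X *m v^T) 0 0.

Definition adjacency (R : realType) (n : nat) (A : 'M[bool]_n) : 'M[R]_n :=
  \matrix_(i, j) (A i j)%:R.

Definition candidate_feasible (R : realType) (n K : nat) (X : 'M[R]_n) : Prop :=
  [/\ psd X, (forall i, \sum_j X i j <= 1), \tr X = K%:R &
      forall i j, 0 <= X i j].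

Definition candidate_optimal (R : realType) (n K : nat) (A : 'M[bool]_n)
    (X : 'M[R]_n) : Prop :=
  candidate_feasible K X /\
  forall X' : 'M[R]_n, candidate_feasible K X' ->
    \tr (adjacency R A *m X'^T) <= \tr (adjacency R A *m X^T).

Definition certificate_set (R : realType) (n K : nat) : set 'M[R]_n :=
  [set Y | [/\ psd Y, (forall i, Y i i = 1), (forall i j, 0 <= Y i j) &
               forall i, \sum_j Y i j = (n %/ K)%:R]].

(* The maximum of a continuous function on a compact set is attained, hence it
   is the supremum. *)
Definition certificate_value (R : realType) (n K : nat) (A : 'M[bool]_n)
    (D lambda theta : R) (Z : 'M[R]_n) : R :=
  sup [set Psi A D lambda Y + theta / n%:R * \sum_i \sum_j `|Y i j - Z i j|
      | Y in @certificate_set R n K].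

(* The algorithm involves arbitrary choices: an optimal solution of the
   candidate program, a labeling it encodes, and a fallback labeling.  They are
   modelled by functions of the input graph subject to this specification. *)
Definition candidate_choice (R : realType) (n K : nat)
    (Xhat : 'M[bool]_n -> 'M[R]_n) (sstar : 'M[bool]_n -> labeling n K) :
    Prop :=
  forall A, is_graph A ->
    [/\ candidate_optimal K A (Xhat A),
        balanced (sstar A) &
        (exists sigma : labeling n K, balanced sigma /\
           (n %/ K)%:R *: Xhat A = cluster_mx R sigma) ->
        (n %/ K)%:R *: Xhat A = cluster_mx R (sstar A)].

Definition proposal (R : realType) (n K : nat) (kappa : R)
    (sstar sigma : labeling n K) : R :=
  \prod_(i < n)
    ((if sigma i == sstar i then 1 else expR (- kappa)) /
     (1 + (K%:R - 1) * expR (- kappa))).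

(* Accepting with probability b is the event {U <= b}, U uniform on [0, 1]; for
   b > 0 it has probability min(1, b). *)
Definition trial_accept (R : realType) (n K : nat) (A : 'M[bool]_n)
    (D lambda eta kappa : R) (sstar sigma : labeling n K) : R :=
  if balanced sigma && canonical_reps sstar sigma then
    proposal kappa sstar sigma *
    Num.min 1 (expR (eta * (score A D lambda sigma - score A D lambda sstar) +
                     kappa * (hamming sigma sstar)%:R))
  else 0.

(* Law of the first accepted proposal: the t-th term is the probability that
   the first t trials are rejected and that the next one accepts sigma. *)
Definition first_accepted (R : realType) (n K : nat) (A : 'M[bool]_n)
    (D lambda eta kappa : R) (sstar sigma : labeling n K) : R :=
  let p := \sum_(tau : labeling n K)
             trial_accept A D lambda eta kappa sstar tau in
  limn (series (fun t : nat =>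
    (1 - p) ^+ t * trial_accept A D lambda eta kappa sstar sigma)).

Definition rejection_sampler (R : realType) (n K : nat) (A : 'M[bool]_n)
    (D lambda eta kappa : R) (sstar tau : labeling n K) : R :=
  \sum_(pi : 'S_K) (K`!%:R)^-1 *
    \sum_(sigma : labeling n K | relabel pi sigma == tau)
      first_accepted A D lambda eta kappa sstar sigma.

(* Law of the output on input A, for a given choice of sstar. *)
Definition main_algorithm (R : realType) (n K : nat)
    (D theta eps lambda : R) (sstar : 'M[bool]_n -> labeling n K)
    (A : 'M[bool]_n) (tau : labeling n K) : R :=
  let eta := eps / (2 * D) in
  let kappa := 2 * eta * theta / K%:R in
  let Z := cluster_mx R (sstar A) in
  if certificate_value K A D lambda theta Z == Psi A D lambda Z
  then rejection_sampler A D lambda eta kappa (sstar A) tau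
  else gibbs A D lambda eta tau.

Definition expected_loss (R : realType) (n K : nat) (a b : R)
    (out : 'M[bool]_n -> labeling n K -> R) (sigma0 : labeling n K) : R :=
  \sum_(A : 'M[bool]_n | is_graph A) sbm_pmf a b sigma0 A *
    \sum_(tau : labeling n K) out A tau * loss R sigma0 tau.

(* Main.v *)
Require Import Defs.
From mathcomp Require Import ring lra zify.
Set Implicit Arguments.
Unset Strict Implicit.
Unset Printing Implicit Defensive.
Local Open Scope classical_set_scope.
Local Open Scope ring_scope.

(** Let [m s] be the number of vertices misaligned between [s] and the ground
    truth [s0], up to relabeling.

    Truncation only helps: by weak duality the score gap [score s - score s0] is
    at most the change in the number of inner edges plus the total inner degree
    of the vertices of inner [s0]-degree above [D], whose mean is at most
    [n * expR (- a / K)].  Since [s] and [s0] disagree on at least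
    [(n / K) * m s / 4] pairs of each kind, a Chernoff bound and a union bound
    over the labelings with [m s >= n * K * expR (- r)], where [r] is of order
    [a / K], show that outside an event of probability [expR (1 - r)] the
    inner edges drop by order [(a / K) * m s] for all of them.  Labelings closer
    to [s0] contribute at most [K * expR (- r)] to the loss.

    This controls the Gibbs law directly.  No analysis of the candidate program
    is needed: a certified labeling maximizes the score, so it is close to [s0]
    by the same score gap, and the rejection sampler, whatever the acceptance
    probabilities, stays at Hamming distance [h] from it with weight at most
    [expR (- kappa * h)]. *)

(** * Generating functions over random graphs *)

(** A graph is determined by its entries above the diagonal, which are free, so the sum is an
    expanded product. This is the independence of the edges. *)
Lemma sum_graph_prod (R : realType) (n : nat) (F : 'I_n -> 'I_n -> bool -> R) :
  \sum_(A : 'M[bool]_n | is_graph A)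
     \prod_(i < n) \prod_(j < n | (i < j)%N) F i j (A i j) =
  \prod_(i < n) \prod_(j < n | (i < j)%N) (F i j true + F i j false).
Proof.
rewrite pair_big_dep /=.
under eq_bigr do rewrite pair_big_dep /=.
pose P := [pred p : 'I_n * 'I_n | (p.1 < p.2)%N].
transitivity (\prod_(p | P p) \sum_(b : bool) F p.1 p.2 b); last first.
  by apply: eq_bigr => p _; rewrite big_bool.
rewrite (big_distr_big false) /=.
(* [up] keeps the upper triangle and [mx] symmetrizes it; they are mutually inverse between graphs
   and boolean functions supported on pairs with i < j. *)
pose up (A : 'M[bool]_n) : {ffun 'I_n * 'I_n -> bool} :=
  [ffun p => P p && A p.1 p.2].
pose mx (f : {ffun 'I_n * 'I_n -> bool}) : 'M[bool]_n :=
  \matrix_(i, j) (f (i, j) || f (j, i)).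
have fam f : f \in pfamily false P (fun=> predT) -> forall p, f p -> P p.
  by move=> /pfamilyP[/fintype.subsetP sub _] p fp; apply: (sub p); rewrite inE fp.
rewrite [RHS](reindex_onto up mx) /=.
  apply: eq_big => [A|A _]; last first.
    by apply: eq_bigr => p Pp; rewrite ffunE /P /= Pp.
  apply/idP/idP.
    move=> /andP[/forallP d /forallP sy]; apply/andP; split.
      apply/pfamilyP; split => //; apply/fintype.subsetP => p.
      by rewrite !inE ffunE eqbF_neg negbK => /andP[].
    apply/eqP/matrixP => i j; rewrite !mxE !ffunE /P /=.
    case: (ltngtP i j) => [_|_|/val_inj <-] /=.
    - by rewrite orbF.
    - by have /forallP/(_ j)/eqP := sy i.
    - by rewrite (negbTE (d i)).
  move=> /andP[_ /eqP <-]; apply/andP; split.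
    apply/forallP => i; rewrite mxE !ffunE /P /= ltnn //.
  by apply/forallP => i; apply/forallP => j; rewrite !mxE orbC.
move=> f /fam Hf; apply/ffunP => -[i j]; rewrite !ffunE mxE /P /=.
have := Hf (i, j); have := Hf (j, i); rewrite /P /=.
case: (f (i, j)) => [_ -> //|].
case: (f (j, i)) => [/(_ isT) h _ /=|_ _]; last by rewrite andbF.
by rewrite andbT; apply/negbTE; rewrite -leqNgt ltnW.
Qed.

(** By independence the left side is a product of factors 1 + p (e^w - 1), and 1 + y <= e^y. All the
    Chernoff bounds below come from this one. *)
Lemma sbm_mgf (R : realType) (n K : nat) (a b : R) (s0 : labeling n K)
    (w : 'I_n -> 'I_n -> R) :
  (forall i j, 0 <= edge_prob a b s0 i j <= 1) ->
  \sum_(A : 'M[bool]_n | is_graph A) sbm_pmf a b s0 A *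
     expR (\sum_(i < n) \sum_(j < n | (i < j)%N) (A i j)%:R * w i j) <=
  expR (\sum_(i < n) \sum_(j < n | (i < j)%N)
           edge_prob a b s0 i j * (expR (w i j) - 1)).
Proof.
move=> p01.
pose F i j (x : bool) := (if x then edge_prob a b s0 i j
   else 1 - edge_prob a b s0 i j) * expR (x%:R * w i j).
rewrite [leLHS](_ : _ = \sum_(A : 'M[bool]_n | is_graph A)
     \prod_(i < n) \prod_(j < n | (i < j)%N) F i j (A i j)); last first.
  apply: eq_bigr => A _; rewrite /sbm_pmf expR_sum -big_split /=.
  by apply: eq_bigr => i _; rewrite expR_sum -big_split.
rewrite sum_graph_prod expR_sum; apply: ler_prod => i _.
apply/andP; split.
  apply: prodr_ge0 => j _; have /andP[p0 p1] := p01 i j.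
  by apply: addr_ge0; apply: mulr_ge0; rewrite ?expR_ge0 ?subr_ge0.
rewrite expR_sum; apply: ler_prod => j _.
have /andP[p0 p1] := p01 i j; apply/andP; split.
  by apply: addr_ge0; apply: mulr_ge0; rewrite ?expR_ge0 ?subr_ge0.
rewrite /F mul1r mul0r expR0 mulr1; apply: le_trans (expR_ge1Dx _).
by rewrite le_eqVlt; apply/orP; left; apply/eqP; ring.
Qed.

Lemma sbm_pmf_ge0 (R : realType) (n K : nat) (a b : R) (s0 : labeling n K)
    (A : 'M[bool]_n) :
  (forall i j, 0 <= edge_prob a b s0 i j <= 1) -> 0 <= sbm_pmf a b s0 A.
Proof.
move=> p01; apply: prodr_ge0 => i _; apply: prodr_ge0 => j _.
by have /andP[p0 p1] := p01 i j; case: ifP => _ //; rewrite subr_ge0.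
Qed.

Lemma sbm_pmf_sum1 (R : realType) (n K : nat) (a b : R) (s0 : labeling n K) :
  \sum_(A : 'M[bool]_n | is_graph A) sbm_pmf a b s0 A = 1.
Proof.
rewrite /sbm_pmf (sum_graph_prod (fun i j (x : bool) => if x then _ else _)).
by apply: big1 => i _; apply: big1 => j _; rewrite addrC subrK.
Qed.

(** * Alignments of labelings and discordant pairs *)

(** Take a permutation agreeing with [f] at as many points of [P] as possible. At a disagreement
    [k], composing with the transposition of [pi k] and [f k] would gain [k] and, by injectivity,
    lose nothing. *)
Lemma perm_extension (T : finType) (P : pred T) (f : T -> T) :
  {in P &, injective f} -> exists pi : {perm T}, {in P, pi =1 f}.
Proof.
move=> injf; pose agree (pi : {perm T}) := #|[pred x | P x && (pi x == f x)]|.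
case: (@arg_maxnP _ (1%g : {perm T}) xpredT agree isT) => pi _ pi_max.
exists pi => k Pk; apply/eqP/negPn/negP => neq.
have := pi_max (pi * tperm (pi k) (f k))%g isT.
move=> /= le; suff: (agree pi < agree (pi * tperm (pi k) (f k))%g)%N by rewrite ltnNge le.
apply: proper_card; apply/properP; split.
  apply/fintype.subsetP => x; rewrite !inE => /andP[Px /eqP e].
  rewrite Px /= permM e tpermD //.
    by rewrite -e (inj_eq perm_inj); apply: contraNneq neq => ->; rewrite e.
  by rewrite (inj_in_eq injf) //; apply: contraNneq neq => ->; rewrite e.
exists k; first by rewrite inE permM tpermL eqxx andbT.
by rewrite inE (negbTE neq) andbF.
Qed.

Definition misaligned (n K : nat) (s0 s : labeling n K) : nat :=
  \big[minn/n]_(pi : 'S_K) hamming (relabel pi s0) s.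

Lemma misaligned_le (n K : nat) (s0 s : labeling n K) (pi : 'S_K) :
  (misaligned s0 s <= hamming (relabel pi s0) s)%N.
Proof.
rewrite /misaligned; elim: (index_enum _) (mem_index_enum pi) => // rho r IH.
rewrite big_cons inE => /predU1P[<-|/IH]; first exact: geq_minl.
exact/leq_trans/geq_minr.
Qed.

Lemma hamming_le (n K : nat) (s t : labeling n K) : (hamming s t <= n)%N.
Proof. by rewrite /hamming -[leqRHS]card_ord max_card. Qed.

Lemma misaligned_le_n (n K : nat) (s0 s : labeling n K) : (misaligned s0 s <= n)%N.
Proof. exact: leq_trans (misaligned_le _ _ 1%g) (hamming_le _ _). Qed.

Lemma misaligned_attained (n K : nat) (s0 s : labeling n K) :
  exists pi, misaligned s0 s = hamming (relabel pi s0) s.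
Proof.
have [e|//] : misaligned s0 s = n \/
    exists pi, misaligned s0 s = hamming (relabel pi s0) s.
  rewrite /misaligned; elim/big_ind: _ => [|x y hx hy|pi _]; first by left.
    by rewrite /minn; case: ifP.
  by right; exists pi.
(* If the minimum equals its default [n], the identity attains it, since no Hamming distance exceeds
   [n]. *)
exists 1%g; apply/eqP; rewrite eqn_leq misaligned_le /= e; exact: hamming_le.
Qed.

Lemma hamming_relabel (n K : nat) (pi : 'S_K) (s t : labeling n K) :
  hamming (relabel pi s) (relabel pi t) = hamming s t.
Proof. by apply: eq_card => i; rewrite !inE !ffunE (inj_eq perm_inj). Qed.

Lemma relabelM (n K : nat) (pi rho : 'S_K) (s : labeling n K) :
  relabel rho (relabel pi s) = relabel (pi * rho)%g s.
Proof. by apply/ffunP => i; rewrite !ffunE permM. Qed.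

Lemma relabel1 (n K : nat) (s : labeling n K) : relabel 1%g s = s.
Proof. by apply/ffunP => i; rewrite !ffunE perm1. Qed.

Lemma cluster_mx_relabel (R : realType) (n K : nat) (pi : 'S_K) (s : labeling n K) :
  cluster_mx R (relabel pi s) = cluster_mx R s.
Proof. by apply/matrixP => i j; rewrite !mxE !ffunE (inj_eq perm_inj). Qed.

Lemma balanced_relabel (n K : nat) (pi : 'S_K) (s : labeling n K) :
  balanced s -> balanced (relabel pi s).
Proof.
move=> /forallP bs; apply/forallP => k; rewrite -(eqP (bs (pi^-1%g k))).
by apply/eqP/eq_card => i; rewrite !inE !ffunE (can2_eq (permK pi) (permKV pi)).
Qed.

(** The best relabeling of [s0] is undone on the side of [s]. This turns the misalignment into a
    plain Hamming distance without changing the cluster matrix, on which alone the score depends. *)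
Lemma misaligned_realigned (n K : nat) (s0 s : labeling n K) :
  balanced s -> exists s' : labeling n K,
  [/\ balanced s', hamming s0 s' = misaligned s0 s, misaligned s0 s' = misaligned s0 s
    & forall R : realType, cluster_mx R s' = cluster_mx R s].
Proof.
move=> bs; have [pi e] := misaligned_attained s0 s.
have hE rho : hamming (relabel rho s0) (relabel pi^-1%g s) =
    hamming (relabel (rho * pi)%g s0) s.
  by rewrite -(hamming_relabel pi) !relabelM mulVg relabel1.
exists (relabel pi^-1%g s); split.
- exact: balanced_relabel.
- by rewrite -[X in hamming X _]relabel1 hE mul1g.
- apply/eqP; rewrite eqn_leq {1}e; apply/andP; split.
    by apply: leq_trans (misaligned_le _ _ 1%g) _; rewrite hE mul1g.
  have [rho ->] := misaligned_attained s0 (relabel pi^-1%g s).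
  by rewrite hE misaligned_le.
- by move=> R; rewrite cluster_mx_relabel.
Qed.

Lemma misaligned_triangle (n K : nat) (s0 s t : labeling n K) :
  (misaligned s0 t <= misaligned s0 s + hamming t s)%N.
Proof.
have [pi ->] := misaligned_attained s0 s.
apply: leq_trans (misaligned_le _ _ pi) _.
rewrite /hamming -cardUI; apply: leq_trans (leq_addr _ _).
apply: subset_leq_card; apply/fintype.subsetP => i; rewrite !inE.
apply: contraNT; rewrite negb_or !negbK => /andP[/eqP -> /eqP ->].
exact: eqxx.
Qed.

Lemma misaligned_relabelr (n K : nat) (s0 s : labeling n K) (pi : 'S_K) :
  (misaligned s0 (relabel pi s) <= misaligned s0 s)%N.
Proof.
have [rho ->] := misaligned_attained s0 s.
by rewrite -(hamming_relabel pi (relabel rho s0)) relabelM misaligned_le.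
Qed.

Lemma card_balanced (n K : nat) (s : labeling n K) (k : 'I_K) :
  balanced s -> #|[pred j | s j == k]| = (n %/ K)%N.
Proof. by move=> /forallP/(_ k)/eqP. Qed.

Lemma card_split_pred (T : finType) (P Q : pred T) :
  (#|[pred j | P j && Q j]| + #|[pred j | P j && ~~ Q j]| = #|[pred j | P j]|)%N.
Proof.
rewrite -(cardID Q [pred j | P j]); congr (_ + _)%N.
by apply: eq_card => j; rewrite !inE andbC.
Qed.

(** Call the cell (k, l) large if it fills more than half of a cluster. Each row and each column has
    at most one large cell, so the large cells extend to a permutation [pi]. A vertex not aligned by
    [pi] lies in a cell that is not large, hence [s] separates it from at least half of its
    [s0]-cluster, and at least [misaligned s0 s] vertices are of this kind. *)
Lemma discordance_ge (n K : nat) (s0 s : labeling n K) :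
  balanced s0 -> balanced s ->
  (n %/ K * misaligned s0 s <=
   2 * \sum_(i < n) #|[pred j | (s0 i == s0 j) && (s i != s j)]|)%N.
Proof.
move=> b0 b; set sz := (n %/ K)%N.
pose c k l := #|[pred j | (k == s0 j) && (l == s j)]|.
have card0 (x : 'I_K) : #|[pred j | x == s0 j]| = sz.
  by rewrite /sz -(card_balanced x b0); apply: eq_card => j; rewrite !inE eq_sym.
have card1 (x : 'I_K) : #|[pred j | x == s j]| = sz.
  by rewrite /sz -(card_balanced x b); apply: eq_card => j; rewrite !inE eq_sym.
have row_le k l l' : l != l' -> (c k l + c k l' <= sz)%N.
  move=> ll; rewrite -(card0 k) /c -cardUI [X in (_ + X)%N]eq_card0 ?addn0.
    by apply: subset_leq_card; apply/fintype.subsetP => j; rewrite !inE => /orP[]/andP[].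
  move=> j; rewrite !inE; apply/negP => /andP[/andP[_ /eqP e]/andP[_ /eqP e']].
  by rewrite e e' eqxx in ll.
have col_le k k' l : k != k' -> (c k l + c k' l <= sz)%N.
  move=> ll; rewrite -(card1 l) /c -cardUI [X in (_ + X)%N]eq_card0 ?addn0.
    by apply: subset_leq_card; apply/fintype.subsetP => j; rewrite !inE => /orP[]/andP[].
  move=> j; rewrite !inE; apply/negP => /andP[/andP[/eqP e _]/andP[/eqP e' _]].
  by rewrite e e' eqxx in ll.
pose f k := odflt k [pick l | (sz < 2 * c k l)%N].
pose good := [pred k | [exists l, (sz < 2 * c k l)%N]].
have fP k : k \in good -> (sz < 2 * c k (f k))%N.
  by move=> /existsP[l hl]; rewrite /f; case: pickP => //= /(_ l); rewrite hl.
have [|pi pif] := @perm_extension _ good f.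
  move=> k k' gk gk' e; apply/eqP/negPn/negP => ne; have := col_le _ _ (f k) ne.
  by have := fP _ gk; have := fP _ gk'; rewrite e; lia.
have half i : pi (s0 i) != s i -> (2 * c (s0 i) (s i) <= sz)%N.
  move=> ne; case: (boolP (s0 i \in good)) => g.
    have := fP _ g; have := row_le (s0 i) _ _ ne.
    by rewrite -(pif _ g); lia.
  by move: g => /existsPn/(_ (s i)); rewrite -leqNgt.
rewrite big_distrr /=; apply: (@leq_trans (sz * hamming (relabel pi s0) s)).
  by rewrite leq_mul2l misaligned_le orbT.
rewrite /hamming -sum1_card big_distrr /= [leqRHS](bigID [pred i | pi (s0 i) != s i]) /=.
apply: leq_trans (leq_addr _ _).
rewrite (eq_bigl [pred i | pi (s0 i) != s i]); last by move=> i; rewrite !inE ffunE.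
apply: leq_sum => i /half; rewrite muln1.
have := card_split_pred [pred j | s0 i == s0 j] [pred j | s i == s j].
by rewrite /= card0 /c => <-; rewrite !mul2n -!addnn leq_add2l leq_add2r.
Qed.

(** The two clusters of [i] have the same size; removing their intersection from each leaves equal
    numbers. *)
Lemma discordance_sym (n K : nat) (s0 s : labeling n K) (i : 'I_n) :
  balanced s0 -> balanced s ->
  #|[pred j | (s i == s j) && (s0 i != s0 j)]| =
  #|[pred j | (s0 i == s0 j) && (s i != s j)]|.
Proof.
move=> b0 b.
have := card_split_pred [pred j | s0 i == s0 j] [pred j | s i == s j].
have := card_split_pred [pred j | s i == s j] [pred j | s0 i == s0 j].
rewrite /= (_ : #|[pred j | s i == s j]| = n %/ K)%N; last first.
  by rewrite -(card_balanced (s i) b); apply: eq_card => j; rewrite !inE eq_sym.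
rewrite (_ : #|[pred j | s0 i == s0 j]| = n %/ K)%N; last first.
  by rewrite -(card_balanced (s0 i) b0); apply: eq_card => j; rewrite !inE eq_sym.
rewrite (@eq_card _ [pred j | (s i == s j) && (s0 i == s0 j)]
  [pred j | (s0 i == s0 j) && (s i == s j)]).
  by move=> <- /eqP; rewrite eqn_add2l => /eqP ->.
by move=> j; rewrite !inE andbC.
Qed.

(** * The truncated score and linear programming duality *)

Lemma sum_lt_sym (V : zmodType) (n : nat) (w : 'I_n -> 'I_n -> V) :
  (forall i j, w i j = w j i) -> (forall i, w i i = 0) ->
  \sum_(i < n) \sum_(j < n) w i j =
  (\sum_(i < n) \sum_(j < n | (i < j)%N) w i j) *+ 2.
Proof.
move=> sy d; rewrite mulr2n.
have -> : \sum_(i < n) \sum_(j < n) w i j =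
    \sum_(i < n) (\sum_(j < n | (i < j)%N) w i j + \sum_(j < n | (j < i)%N) w i j).
  apply: eq_bigr => i _; rewrite (bigID (fun j : 'I_n => (i < j)%N)) /=; congr (_ + _).
  rewrite (bigID (fun j : 'I_n => j == i)) /= [X in X + _]big1 ?add0r.
    apply: eq_bigl => j; rewrite -leqNgt ltn_neqAle andbC.
    by rewrite (inj_eq val_inj).
  by move=> j /andP[_ /eqP ->].
rewrite big_split /=; congr (_ + _).
rewrite (exchange_big_dep xpredT) //=; apply: eq_bigr => i _.
by apply: eq_big => // j _; rewrite sy.
Qed.

Definition within (R : realType) (n K : nat) (A : 'M[bool]_n) (s : labeling n K) : R :=
  \sum_(i < n) \sum_(j < n | (i < j)%N) (A i j)%:R * cluster_mx R s i j.

(** Written as a weighted edge sum with incidence indicators, which fits both the dual constraint of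
    [H_ext_ge] and the exponent of [sbm_mgf]. *)
Definition inner_deg (R : realType) (n K : nat) (A : 'M[bool]_n)
    (s : labeling n K) (k : 'I_n) : R :=
  \sum_(i < n) \sum_(j < n | (i < j)%N)
     (A i j)%:R * (cluster_mx R s i j * ((i == k)%:R + (j == k)%:R)).

Definition excess (R : realType) (n K : nat) (A : 'M[bool]_n) (D : R)
    (s : labeling n K) : R :=
  \sum_(k < n) if inner_deg R A s k <= D then 0 else inner_deg R A s k.

Lemma cluster_mx_ge0 (R : realType) (n K : nat) (s : labeling n K) i j :
  0 <= cluster_mx R s i j.
Proof. by rewrite mxE ler0n. Qed.

Lemma cluster_mx_sym (R : realType) (n K : nat) (s : labeling n K) i j :
  cluster_mx R s i j = cluster_mx R s j i.
Proof. by rewrite !mxE eq_sym. Qed.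

Lemma cluster_mx_diag (R : realType) (n K : nat) (s : labeling n K) i :
  cluster_mx R s i i = 1.
Proof. by rewrite mxE eqxx. Qed.

Lemma cluster_mx_row (R : realType) (n K : nat) (s : labeling n K) i :
  balanced s -> \sum_j cluster_mx R s i j = (n %/ K)%:R.
Proof.
move=> bs; rewrite -(card_balanced (s i) bs) -sum1_card natr_sum [RHS]big_mkcond /=.
by apply: eq_bigr => j _; rewrite mxE inE eq_sym; case: eqP.
Qed.

(** This cancels the [lambda] penalty between balanced labelings. *)
Lemma cluster_mx_sum_lt (R : realType) (n K : nat) (s t : labeling n K) :
  balanced s -> balanced t ->
  \sum_(i < n) \sum_(j < n | (i < j)%N) cluster_mx R s i j =
  \sum_(i < n) \sum_(j < n | (i < j)%N) cluster_mx R t i j.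
Proof.
move=> bs bt; apply/eqP; rewrite -subr_eq0 -sumrB.
under eq_bigr do rewrite -sumrB.
(* Doubling the difference turns it into a sum over all ordered pairs, where row sums can be
   used. *)
rewrite -[_ == 0]/((2 == 0)%N || (_ == 0)) -mulrn_eq0 -sum_lt_sym /=.
- apply/eqP/big1 => i _; by rewrite sumrB !cluster_mx_row ?subrr.
- by move=> i j; rewrite cluster_mx_sym [X in _ - X]cluster_mx_sym.
- by move=> i; rewrite !cluster_mx_diag subrr.
Qed.

Lemma H_objective_ge0 (R : realType) (n : nat) (A : 'M[bool]_n) (D : R)
    (Y : 'M[R]_n) q z :
  0 <= D -> (forall i j, 0 <= Y i j) -> H_feasible A q z ->
  0 <= H_objective A D Y q z.
Proof.
move=> D0 Y0 [hq hz]; apply: addr_ge0.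
  apply: sumr_ge0 => i _; apply: sumr_ge0 => j /andP[ij Aij].
  by apply: mulr_ge0 => //; have [/andP[]] := hz _ _ ij Aij.
by apply: mulr_ge0 => //; apply: sumr_ge0 => i _; have /andP[] := hq i.
Qed.

(** The point q = 0, z = 1 is feasible and its objective is the untruncated edge sum. *)
Lemma H_ext_le (R : realType) (n : nat) (A : 'M[bool]_n) (D : R) (Y : 'M[R]_n) :
  0 <= D -> (forall i j, 0 <= Y i j) ->
  H_ext A D Y <= \sum_(i < n) \sum_(j < n | (i < j)%N) (A i j)%:R * Y i j.
Proof.
move=> D0 Y0; apply: ge_inf.
  by exists 0 => v [q [z [feas ->]]]; exact: H_objective_ge0.
exists (fun=> 0), (const_mx 1); split.
  by split=> [i|i j _ _]; rewrite ?mxE !lexx ler01 // !subr0.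
rewrite /H_objective [X in D * X]big1 // mulr0 addr0; apply: eq_bigr => i _.
rewrite [RHS]big_mkcond [LHS]big_mkcond; apply: eq_bigr => j _ /=.
by rewrite mxE; case: ifP => //= _; case: (A i j); rewrite ?mul0r.
Qed.

(* Weak duality: [w] is a feasible point of the dual linear program. *)
Lemma H_ext_ge (R : realType) (n : nat) (A : 'M[bool]_n) (D : R) (Y : 'M[R]_n)
    (w : 'I_n -> 'I_n -> R) :
  (forall i j, 0 <= w i j <= Y i j) ->
  (forall k, \sum_(i < n) \sum_(j < n | (i < j)%N && A i j)
     w i j * ((i == k)%:R + (j == k)%:R) <= D) ->
  \sum_(i < n) \sum_(j < n | (i < j)%N && A i j) w i j <= H_ext A D Y.
Proof.
move=> wY wD; apply: lb_le_inf.
  exists (H_objective A D Y (fun=> 0) (const_mx 1)), (fun=> 0), (const_mx 1).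
  by split=> //; split=> [i|i j _ _]; rewrite ?mxE !lexx ler01 // !subr0.
move=> v [q [z [[hq hz] ->]]]; rewrite /H_objective.
have qD : \sum_(i < n) \sum_(j < n | (i < j)%N && A i j) w i j * (q i + q j) <=
    D * \sum_(i < n) q i.
  (* Expanding [q] over indicators lets the constraint of vertex [k] be weighted by [q k] and
     summed. *)
  have pick i : q i = \sum_k q k * (i == k)%:R.
    rewrite (bigD1 i) //= eqxx mulr1 big1 ?addr0 // => k /negbTE ne.
    by rewrite eq_sym ne mulr0.
  rewrite mulr_sumr.
  have -> : \sum_(i < n) \sum_(j < n | (i < j)%N && A i j) w i j * (q i + q j) =
     \sum_k q k * \sum_(i < n) \sum_(j < n | (i < j)%N && A i j)
       w i j * ((i == k)%:R + (j == k)%:R).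
    under [RHS]eq_bigr do (rewrite mulr_sumr; under eq_bigr do rewrite mulr_sumr).
    rewrite [RHS]exchange_big; apply: eq_bigr => i _ /=.
    rewrite exchange_big; apply: eq_bigr => j _ /=.
    rewrite {1}(pick i) {1}(pick j) -big_split mulr_sumr; apply: eq_bigr => k _ /=.
    ring.
  apply: ler_sum => k _; rewrite mulrC; apply: ler_wpM2r => //.
  by have /andP[] := hq k.
apply: (le_trans _ (lerD (lexx _) qD)); rewrite -big_split /=.
apply: ler_sum => i _; rewrite -big_split /=; apply: ler_sum => j /andP[ij Aij].
have /andP[w0 wy] := wY i j; have [/andP[z0 z1] zq] := hz _ _ ij Aij.
rewrite -lerBlDr; apply: (@le_trans _ _ (z i j * w i j)).
  by rewrite -[X in X - _]mulr1 -mulrBr mulrC; apply: ler_wpM2r => //; lra.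
exact: ler_wpM2l.
Qed.

Lemma inner_deg_ge0 (R : realType) (n K : nat) (A : 'M[bool]_n)
    (s : labeling n K) k : 0 <= inner_deg R A s k.
Proof.
apply: sumr_ge0 => i _; apply: sumr_ge0 => j _; apply: mulr_ge0 => //.
by rewrite mulr_ge0 ?cluster_mx_ge0 ?addr_ge0.
Qed.

Lemma excess_ge0 (R : realType) (n K : nat) (A : 'M[bool]_n) (D : R)
    (s : labeling n K) : 0 <= excess A D s.
Proof. by apply: sumr_ge0 => k _; case: ifP => // _; exact: inner_deg_ge0. Qed.

(* The dual point of [H_ext_ge] keeps the inner edges between vertices of inner
   degree at most [D]; the others are charged to their large-degree endpoints. *)
Lemma H_ext_cluster_ge (R : realType) (n K : nat) (A : 'M[bool]_n) (D : R)
    (s : labeling n K) :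
  0 <= D -> within R A s - excess A D s <= H_ext A D (cluster_mx R s).
Proof.
move=> D0; pose Y := cluster_mx R s; pose g k := inner_deg R A s k <= D.
pose w i j : R := Y i j * (g i && g j)%:R.
have Y0 i j : 0 <= Y i j := cluster_mx_ge0 R s i j.
have wY i j : 0 <= w i j <= Y i j.
  by rewrite mulr_ge0 //= ler_piMr // lern1 leq_b1.
have wmk f : \sum_(i < n) \sum_(j < n | (i < j)%N && A i j) w i j * f i j =
    \sum_(i < n) \sum_(j < n | (i < j)%N) (A i j)%:R * (w i j * f i j).
  apply: eq_bigr => i _; rewrite [RHS]big_mkcond [LHS]big_mkcond.
  apply: eq_bigr => j _ /=; case: (i < j)%N => //=.
  by case: (A i j); rewrite ?mul0r ?mul1r.
apply: (le_trans _ (@H_ext_ge _ _ A D Y w wY _)); last first.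
  move=> k; rewrite (wmk (fun i j => (i == k)%:R + (j == k)%:R)).
  case: (boolP (g k)) => gk.
    apply: le_trans gk; apply: ler_sum => i _; apply: ler_sum => j _.
    apply: ler_wpM2l => //; apply: ler_wpM2r; first by rewrite addr_ge0.
    by have /andP[] := wY i j.
  apply: le_trans D0; rewrite big1 // => i _; rewrite big1 // => j _.
  case: eqP => [->|_]; first by rewrite /w (negbTE gk) mulr0 mul0r mulr0.
  case: eqP => [->|_]; first by rewrite /w (negbTE gk) andbF mulr0 mul0r mulr0.
  by rewrite addr0 !mulr0.
have -> : \sum_(i < n) \sum_(j < n | (i < j)%N && A i j) w i j =
    \sum_(i < n) \sum_(j < n | (i < j)%N) (A i j)%:R * w i j.
  under eq_bigr do under eq_bigr do rewrite -[w _ _]mulr1.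
  rewrite (wmk (fun _ _ => 1)).
  by apply: eq_bigr => i _; apply: eq_bigr => j _; rewrite mulr1.
rewrite lerBlDr -lerBlDl -sumrB.
under eq_bigr do rewrite -sumrB.
have -> : excess A D s = \sum_(k < n) (~~ g k)%:R * inner_deg R A s k.
  by apply: eq_bigr => k _; rewrite -/(g k); case: (g k); rewrite ?mul0r ?mul1r.
have pick i : (~~ g i)%:R = \sum_k (~~ g k)%:R * (i == k)%:R :> R.
  rewrite (bigD1 i) //= eqxx mulr1 big1 ?addr0 // => k /negbTE ne.
  by rewrite eq_sym ne mulr0.
under [leRHS]eq_bigr do (rewrite mulr_sumr; under eq_bigr do rewrite mulr_sumr).
rewrite [leRHS]exchange_big /=; apply: ler_sum => i _.
rewrite [leRHS]exchange_big /=; apply: ler_sum => j _.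
rewrite (_ : \sum_(k < n) _ = (A i j)%:R * (Y i j * ((~~ g i)%:R + (~~ g j)%:R))).
  (* A discarded inner edge has an endpoint of large degree, so it is charged at least once. *)
  rewrite -mulrBr; apply: ler_wpM2l => //; rewrite /w -[X in X - _]mulr1 -mulrBr.
  apply: ler_wpM2l => //.
  by case: (g i); case: (g j) => /=; rewrite ?subrr ?subr0 ?addr0 ?add0r // lerDl.
rewrite {1}(pick i) {1}(pick j) -big_split !mulr_sumr; apply: eq_bigr => k _ /=.
rewrite /Y; ring.
Qed.

(** Truncation lowers the score of [s], so only the edges truncated at [s0] have to be paid for. *)
Lemma score_sub_le (R : realType) (n K : nat) (A : 'M[bool]_n) (D lambda : R)
    (s0 s : labeling n K) :
  0 <= D -> balanced s0 -> balanced s ->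
  score A D lambda s - score A D lambda s0 <=
  within R A s - within R A s0 + excess A D s0.
Proof.
move=> D0 b0 b; rewrite /score /Psi (cluster_mx_sum_lt R b b0).
have := H_ext_cluster_ge A s0 D0.
have := @H_ext_le _ _ A _ (cluster_mx R s) D0 (cluster_mx_ge0 R s).
rewrite -/(within R A s); lra.
Qed.

(** * Chernoff bounds under the block model *)

Definition sbm_mean (R : realType) (n K : nat) (a b : R) (s0 : labeling n K)
    (f : 'M[bool]_n -> R) : R :=
  \sum_(A : 'M[bool]_n | is_graph A) sbm_pmf a b s0 A * f A.

Lemma sbm_mean_le (R : realType) (n K : nat) (a b : R) (s0 : labeling n K)
    (f g : 'M[bool]_n -> R) :
  (forall i j, 0 <= edge_prob a b s0 i j <= 1) ->
  (forall A, is_graph A -> f A <= g A) -> sbm_mean a b s0 f <= sbm_mean a b s0 g.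
Proof.
by move=> p01 fg; apply: ler_sum => A gA; rewrite ler_wpM2l ?fg ?sbm_pmf_ge0.
Qed.

Lemma sbm_mean_sum (R : realType) (n K : nat) (a b : R) (s0 : labeling n K)
    (I : finType) (P : pred I) (f : I -> 'M[bool]_n -> R) :
  sbm_mean a b s0 (fun A => \sum_(i | P i) f i A) =
  \sum_(i | P i) sbm_mean a b s0 (f i).
Proof.
rewrite /sbm_mean [RHS]exchange_big /=.
by apply: eq_bigr => A _; rewrite mulr_sumr.
Qed.

Lemma sbm_meanZ (R : realType) (n K : nat) (a b : R) (s0 : labeling n K)
    (c : R) (f : 'M[bool]_n -> R) :
  sbm_mean a b s0 (fun A => c * f A) = c * sbm_mean a b s0 f.
Proof. by rewrite /sbm_mean mulr_sumr; apply: eq_bigr => A _; ring. Qed.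

Lemma sbm_meanD (R : realType) (n K : nat) (a b : R) (s0 : labeling n K)
    (f g : 'M[bool]_n -> R) :
  sbm_mean a b s0 (fun A => f A + g A) = sbm_mean a b s0 f + sbm_mean a b s0 g.
Proof. by rewrite /sbm_mean -big_split /=; apply: eq_bigr => A _; ring. Qed.

Lemma sbm_mean_cst (R : realType) (n K : nat) (a b : R) (s0 : labeling n K) (c : R) :
  sbm_mean a b s0 (fun=> c) = c.
Proof. by rewrite /sbm_mean -mulr_suml sbm_pmf_sum1 mul1r. Qed.

(** For x > D one has x <= e^x <= e^(2x - D): one half of 2x pays for the factor x, the other for
    the tail. *)
Lemma excess_term_le (R : realType) (x D : R) :
  0 <= x -> (if x <= D then 0 else x) <= expR (2 * x - D).
Proof.
move=> x0; case: (leP x D) => [_|Dx]; first exact: expR_ge0.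
have := expR_ge1Dx x; have : expR x <= expR (2 * x - D) by rewrite ler_expR; lra.
lra.
Qed.

(** A vertex has mean inner degree at most a / K, so the exponential moment at parameter 2 is at
    most exp((e^2 - 1) a / K). The factor e^(-D) with D >= e^2 a / K brings this down to e^(-a /
    K). *)
Lemma mean_excess_le (R : realType) (n K : nat) (a b D : R) (s0 : labeling n K) :
  (K %| n)%N -> (0 < n)%N -> (forall i j, 0 <= edge_prob a b s0 i j <= 1) ->
  balanced s0 -> 0 <= a -> expR 2 * (a / K%:R) <= D ->
  sbm_mean a b s0 (fun A => excess A D s0) <= n%:R * expR (- (a / K%:R)).
Proof.
move=> Kn n0 p01 b0 a0 aD; rewrite sbm_mean_sum.
apply: (@le_trans _ _ (\sum_(k < n) expR (- (a / K%:R)))); last first.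
  by rewrite sumr_const card_ord mulr_natl.
apply: ler_sum => k _.
pose w i j := 2 * (cluster_mx R s0 i j * ((i == k)%:R + (j == k)%:R)).
have degE A : 2 * inner_deg R A s0 k =
    \sum_(i < n) \sum_(j < n | (i < j)%N) (A i j)%:R * w i j.
  rewrite mulr_sumr; apply: eq_bigr => i _; rewrite mulr_sumr.
  by apply: eq_bigr => j _; rewrite /w; ring.
apply: (@le_trans _ _ (expR (- D) * expR ((expR 2 - 1) * (a / K%:R)))); last first.
  by rewrite -expRD ler_expR; lra.
apply: (@le_trans _ _ (sbm_mean a b s0 (fun A => expR (- D) *
    expR (\sum_(i < n) \sum_(j < n | (i < j)%N) (A i j)%:R * w i j)))).
  apply: sbm_mean_le => // A _; rewrite -degE -expRD addrC.
  exact/excess_term_le/inner_deg_ge0.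
rewrite sbm_meanZ; apply: ler_wpM2l; first exact: expR_ge0.
apply: le_trans (sbm_mgf w p01) _; rewrite ler_expR.
have e2 : 0 <= expR 2 - 1 :> R by rewrite subr_ge0 -expR0 ler_expR.
have an : 0 <= a / n%:R by rewrite divr_ge0.
pose f i j : R := if i == j then 0
  else cluster_mx R s0 i j * ((i == k)%:R + (j == k)%:R).
apply: (@le_trans _ _ ((expR 2 - 1) * (a / n%:R) *
    \sum_(i < n) \sum_(j < n | (i < j)%N) f i j)).
  rewrite mulr_sumr; apply: ler_sum => i _; rewrite mulr_sumr.
  (* As i and j differ, at most one equals [k]; the weight is 0 or 2 and e^w - 1 is proportional to
     the indicator. *)
  apply: ler_sum => j ij; rewrite /w /f /edge_prob mxE.
  have ne : i != j by rewrite -(inj_eq val_inj) neq_ltn ij.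
  rewrite (negbTE ne); case: ifP => _; last first.
    by rewrite mul0r mulr0 expR0 subrr !mulr0.
  rewrite mul1r; case: (eqVneq i k) => [e|_] /=.
    by rewrite -e eq_sym (negbTE ne) addr0 !mulr1 mulrC.
  by case: eqP => _ /=; rewrite add0r ?mulr1 ?mulr0 ?expR0 ?subrr ?mulr0 // mulrC.
rewrite -mulrA; apply: ler_wpM2l => //.
have -> : a / K%:R = a / n%:R * (n %/ K)%:R.
  have K0 : (0 < K)%N by rewrite (dvdn_gt0 n0).
  rewrite natf_div // mulrA mulrVK //.
  by rewrite unitfE pnatr_eq0 -lt0n.
apply: ler_wpM2l => //; rewrite -(@ler_pMn2r _ 2) //.
rewrite -sum_lt_sym; last first.
- by move=> i; rewrite /f eqxx.
- by move=> i j; rewrite /f eq_sym cluster_mx_sym [X in _ * X]addrC.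
apply: (@le_trans _ _ (\sum_(i < n) \sum_(j < n)
     (cluster_mx R s0 i j * (i == k)%:R + cluster_mx R s0 i j * (j == k)%:R))).
  apply: ler_sum => i _; apply: ler_sum => j _; rewrite -mulrDr /f.
  by case: ifP => // _; rewrite mulr_ge0 ?cluster_mx_ge0 ?addr_ge0.
under eq_bigr do rewrite big_split /=.
rewrite big_split /= mulr2n; apply: lerD.
  under eq_bigr do rewrite -mulr_suml cluster_mx_row //.
  rewrite -mulr_sumr (bigD1 k) //= eqxx big1 ?addr0 ?mulr1 //.
  by move=> i /negbTE ->.
rewrite exchange_big /=.
under eq_bigr => j _.
  rewrite -mulr_suml; under eq_bigr do rewrite cluster_mx_sym.
  rewrite cluster_mx_row //; over.
rewrite -mulr_sumr (bigD1 k) //= eqxx big1 ?addr0 ?mulr1 //.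
by move=> i /negbTE ->.
Qed.

(** With tilt -ln v, a lost inner pair contributes (a / n)(v - 1) and a gained one (b / n)(1/v - 1).
    Both kinds are equally many, and for b <= v^2 a the sum is at most -(a / n)(1 - v)^2; the tilt
    is the optimal one at b = v^2 a. *)
Lemma mean_drift_le (R : realType) (n K : nat) (a b v : R) (s0 s : labeling n K) :
  (K %| n)%N -> (0 < n)%N -> (forall i j, 0 <= edge_prob a b s0 i j <= 1) ->
  balanced s0 -> balanced s -> 0 <= a -> 0 < v < 1 -> b <= v ^+ 2 * a ->
  sbm_mean a b s0 (fun A => expR (- ln v * (within R A s - within R A s0))) <=
  expR (- ((1 - v) ^+ 2 / 4 * (a / K%:R) * (misaligned s0 s)%:R)).
Proof.
move=> Kn n0 p01 b0 bs a0 /andP[v0 v1] bv.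
pose w i j := - ln v * (cluster_mx R s i j - cluster_mx R s0 i j).
have dE A : - ln v * (within R A s - within R A s0) =
    \sum_(i < n) \sum_(j < n | (i < j)%N) (A i j)%:R * w i j.
  rewrite -sumrB mulr_sumr; apply: eq_bigr => i _; rewrite -sumrB mulr_sumr.
  by apply: eq_bigr => j _; rewrite /w; ring.
under [X in sbm_mean _ _ _ X]funext do rewrite dE.
apply: le_trans (sbm_mgf w p01) _; rewrite ler_expR.
(* [N] counts ordered pairs, hence twice the discordant pairs of each kind; with the 2 of
   [discordance_ge] this makes the constant 1/4. *)
pose N := \sum_(i < n) #|[pred j | (s0 i == s0 j) && (s i != s j)]|.
have NE : \sum_(i < n) \sum_(j < n) edge_prob a b s0 i j * (expR (w i j) - 1) =
    N%:R * (a / n%:R * (v - 1) + b / n%:R * (v^-1 - 1)).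
  rewrite natr_sum mulr_suml; apply: eq_bigr => i _.
  rewrite mulrDr -{2}(discordance_sym i b0 bs) -!sum1_card !natr_sum !mulr_suml.
  rewrite [X in _ = X + _]big_mkcond [X in _ = _ + X]big_mkcond -big_split /=.
  apply: eq_bigr => j _; rewrite /w /edge_prob !mxE !inE.
  case: (s0 i == s0 j); case: (s i == s j); rewrite /= ?subrr ?subr0 ?sub0r.
  - by rewrite mulr0 expR0 subrr mulr0 addr0.
  - by rewrite mulrNN mulr1 lnK ?posrE // addr0 mul1r.
  - by rewrite mulr1 expRN lnK ?posrE // add0r mul1r.
  - by rewrite mulr0 expR0 subrr mulr0 addr0.
have n0R : 0 < n%:R :> R by rewrite ltr0n.
have K0 : (0 < K)%N by rewrite (dvdn_gt0 n0).
have K0R : 0 < K%:R :> R by rewrite ltr0n.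
rewrite -(@ler_pMn2r _ 2) // -sum_lt_sym; last first.
- by move=> i; rewrite /w !mxE !eqxx subrr mulr0 expR0 subrr mulr0.
- move=> i j; rewrite /w /edge_prob [s0 i == _]eq_sym.
  by rewrite (cluster_mx_sym R s i) (cluster_mx_sym R s0 i).
rewrite NE.
have Nge : (n %/ K)%:R * (misaligned s0 s)%:R <= 2 * N%:R :> R.
  by rewrite -!natrM ler_nat discordance_ge.
have nK : n%:R = (n %/ K)%:R * K%:R :> R by rewrite -natrM divnK.
have sz0 : 0 < (n %/ K)%:R :> R by rewrite ltr0n divn_gt0 // dvdn_leq.
have drift : a / n%:R * (v - 1) + b / n%:R * (v^-1 - 1) <=
    - (a / n%:R * (1 - v) ^+ 2).
  have : b / n%:R * (v^-1 - 1) <= v ^+ 2 * a / n%:R * (v^-1 - 1).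
    apply: ler_wpM2r; first by rewrite subr_ge0 invf_ge1 // ltW.
    by apply: ler_wpM2r => //; rewrite invr_ge0 ltW.
  have -> : v ^+ 2 * a / n%:R * (v^-1 - 1) = a / n%:R * (v - v ^+ 2).
    by field; rewrite !gt_eqF.
  nra.
apply: (@le_trans _ _ (N%:R * - (a / n%:R * (1 - v) ^+ 2))).
  exact: ler_wpM2l.
rewrite mulrN mulNrn lerN2.
have -> : (1 - v) ^+ 2 / 4 * (a / K%:R) * (misaligned s0 s)%:R *+ 2 =
   (n %/ K)%:R * (misaligned s0 s)%:R * (a / n%:R * (1 - v) ^+ 2 / 2).
  by rewrite nK -mulr_natr; field; rewrite !gt_eqF.
have -> : N%:R * (a / n%:R * (1 - v) ^+ 2) =
   2 * N%:R * (a / n%:R * (1 - v) ^+ 2 / 2) by field; rewrite gt_eqF.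
apply: ler_wpM2r => //.
by rewrite divr_ge0 // mulr_ge0 ?sqr_ge0 // divr_ge0.
Qed.

(** * Sums over labelings and the separation event *)

(** The sum factors over vertices: each has one agreeing label and K - 1 others. It is also the
    normalization of the proposal law. *)
Lemma sum_expr_hamming (R : realType) (n K : nat) (s0 : labeling n K) (x : R) :
  \sum_(s : labeling n K) x ^+ hamming s0 s = (1 + (K%:R - 1) * x) ^+ n.
Proof.
transitivity (\sum_(s : labeling n K) \prod_(i < n) if s0 i == s i then 1 else x).
  apply: eq_bigr => s _; rewrite /hamming -prodr_const [LHS]big_mkcond /=.
  by apply: eq_bigr => i _; rewrite inE; case: eqP.
rewrite -(bigA_distr_bigA (fun i l => if s0 i == l then 1 else x)) /=.
rewrite -[in RHS](card_ord n) -prodr_const; apply: eq_bigr => i _.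
rewrite (bigD1 (s0 i)) //= eqxx; congr (_ + _).
rewrite (eq_bigr (fun=> x)); last by move=> l /negbTE; rewrite eq_sym => ->.
rewrite sumr_const -[LHS]mulr_natl; congr (_ * _).
have := cardC1 (s0 i); rewrite card_ord => e.
rewrite (@eq_card _ _ (predC1 (s0 i))) ?e //.
by have K0 : (0 < K)%N := leq_ltn_trans (leq0n _) (ltn_ord (s0 i));
  rewrite -subn1 natrB.
Qed.

Lemma sum_expr_hamming_le (R : realType) (n K : nat) (s0 : labeling n K) (x : R) :
  0 <= x -> \sum_(s : labeling n K) x ^+ hamming s0 s <= expR (n%:R * K%:R * x).
Proof.
move=> x0; rewrite sum_expr_hamming -mulrA expRM_natl.
have [->|n0] := posnP n; first by rewrite !expr0.
have y0 : 0 <= 1 + (K%:R - 1) * x.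
  have K0 : (0 < K)%N := leq_ltn_trans (leq0n _) (ltn_ord (s0 (Ordinal n0))).
  by rewrite addr_ge0 // mulr_ge0 // subr_ge0 ler1n.
apply: lerXn2r; rewrite ?nnegrE ?expR_ge0 //.
apply: le_trans (expR_ge1Dx _); rewrite lerD2l; apply: ler_wpM2r => //; lra.
Qed.

(** The term at [s0] vanishes and all distances are at most [n], so the sum is at most n (e^t - 1)
    with t = nKx, and e^t <= 1 + 2t for t <= 1/2. *)
Lemma sum_hamming_weight_le (R : realType) (n K : nat) (s0 : labeling n K) (x : R) :
  0 <= x -> n%:R * K%:R * x <= 1 / 2 ->
  \sum_(s : labeling n K) (hamming s0 s)%:R * x ^+ hamming s0 s <=
  2 * n%:R ^+ 2 * K%:R * x.
Proof.
move=> x0 small; set t := n%:R * K%:R * x in small *.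
have t0 : 0 <= t by rewrite !mulr_ge0.
have tle : expR t <= 1 + 2 * t.
  have := expR_ge1Dx (- t); rewrite expRN => h.
  have tp : 0 < 1 - t by lra.
  apply: (@le_trans _ _ (1 - t)^-1).
    by rewrite -[leLHS]invrK lef_pV2 ?posrE ?invr_gt0 ?expR_gt0.
  by rewrite -div1r ler_pdivrMr //; nra.
apply: (@le_trans _ _ (n%:R * (\sum_(s : labeling n K) x ^+ hamming s0 s - 1))).
  have h0 : hamming s0 s0 = 0%N by apply: eq_card0 => i; rewrite !inE eqxx.
  rewrite (bigD1 s0) //= h0 mul0r add0r [in leRHS](bigD1 s0) //= h0 expr0 addrAC subrr.
  rewrite add0r mulr_sumr; apply: ler_sum => s _.
  by apply: ler_wpM2r; rewrite ?exprn_ge0 // ler_nat hamming_le.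
have -> : 2 * n%:R ^+ 2 * K%:R * x = n%:R * (2 * t) by rewrite /t; ring.
apply: ler_wpM2l => //; have := sum_expr_hamming_le s0 x0; rewrite -/t; lra.
Qed.

(** The radius [mu] exempts labelings so close to [s0] that the Chernoff bound may not beat their
    number. *)
Definition separated (R : realType) (n K : nat) (s0 : labeling n K) (delta mu : R)
    (A : 'M[bool]_n) : Prop :=
  forall s : labeling n K, balanced s -> (0 < misaligned s0 s)%N ->
    mu <= (misaligned s0 s)%:R ->
    within R A s - within R A s0 <= - (delta * (misaligned s0 s)%:R).

(* Labelings at distance [h >= max(1, mu)] are so rare that the weights
   [expR (- (2 * r * h))] sum to at most [expR (1 - r)]. *)
Lemma mean_not_separated_le (R : realType) (n K : nat) (a b v : R)
    (s0 : labeling n K) :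
  let r := (1 - v) ^+ 2 / 16 * (a / K%:R) in
  (K %| n)%N -> (0 < n)%N -> (forall i j, 0 <= edge_prob a b s0 i j <= 1) ->
  balanced s0 -> 0 <= a -> 0 < v < 1 -> b <= v ^+ 2 * a -> 1 <= r ->
  sbm_mean a b s0 (fun A => (~~ `[< separated s0 (2 * r / - ln v)
      (n%:R * K%:R * expR (- r)) A >])%:R) <= expR (1 - r).
Proof.
move=> r Kn n0 p01 b0 a0 v01 bv r1; set mu := n%:R * K%:R * expR (- r).
have /andP[v0 v1] := v01.
have u0 : 0 < - ln v by rewrite oppr_gt0 ln_lt0 ?v0.
set delta := 2 * r / - ln v.
(* The union bound runs over aligned labelings only, so that the misalignment in the exponent is a
   Hamming distance. *)
pose P (s : labeling n K) := [&& balanced s, hamming s0 s == misaligned s0 s,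
   (0 < misaligned s0 s)%N & mu <= (misaligned s0 s)%:R].
(* Exponential Markov weight: it is at least 1 at any labeling violating separation. *)
pose E A (s : labeling n K) := expR (2 * r * (misaligned s0 s)%:R) *
  expR (- ln v * (within R A s - within R A s0)).
apply: (@le_trans _ _ (sbm_mean a b s0 (fun A => \sum_(s | P s) E A s))).
  apply: sbm_mean_le => // A _.
  have E0 s : 0 <= E A s by rewrite mulr_ge0 ?expR_ge0.
  case: asboolP => [_|bad] /=; first exact: sumr_ge0.
  have [s [bs [m0 [mmu lt]]]] : exists s : labeling n K, balanced s /\
      (0 < misaligned s0 s)%N /\ mu <= (misaligned s0 s)%:R /\
      - (delta * (misaligned s0 s)%:R) < within R A s - within R A s0.
    apply: contrapT => no; apply: bad => s bs m0 mmu; rewrite leNgt; apply/negP => lt.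
    by apply: no; exists s.
  have [s' [bs' hs' ms' cs']] := misaligned_realigned s0 bs.
  have Ps' : P s' by rewrite /P bs' ms' hs' eqxx m0.
  rewrite (bigD1 s') //=; apply: ler_wpDr; first exact: sumr_ge0.
  rewrite /E -expRD -[leLHS]expR0 ler_expR ms'.
  have -> : within R A s' = within R A s by rewrite /within cs'.
  have : - ln v * - (delta * (misaligned s0 s)%:R) <=
      - ln v * (within R A s - within R A s0) by rewrite ler_pM2l // ltW.
  have -> : - ln v * - (delta * (misaligned s0 s)%:R) = - (2 * r * (misaligned s0 s)%:R).
    by rewrite /delta; field; rewrite lt_eqF // -oppr_gt0.
  lra.
rewrite sbm_mean_sum.
apply: (@le_trans _ _ (\sum_(s : labeling n K)
    expR (1 - r) * expR (- mu) * expR (- r) ^+ hamming s0 s)).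
  rewrite [leLHS]big_mkcond; apply: ler_sum => s _; case: ifP => [|_]; last first.
    by rewrite !mulr_ge0 ?expR_ge0 // exprn_ge0 ?expR_ge0.
  move=> /and4P[bs /eqP hs m0 mmu].
  rewrite sbm_meanZ.
  apply: (@le_trans _ _ (expR (2 * r * (misaligned s0 s)%:R) *
     expR (- ((1 - v) ^+ 2 / 4 * (a / K%:R) * (misaligned s0 s)%:R)))).
    by apply: ler_wpM2l; rewrite ?expR_ge0 // mean_drift_le.
  rewrite -expRM_natl -!expRD ler_expR hs.
  have -> : (1 - v) ^+ 2 / 4 * (a / K%:R) = 4 * r by rewrite /r; set y := a / _; field.
  (* Writing m for the misalignment, the exponent left is -2rm. One half is kept as -rm, the other
     is at most 1 - r - mu because r (m - 1) >= m - 1 >= mu - 1. *)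
  have : 1 <= (misaligned s0 s)%:R :> R by rewrite ler1n.
  by nra.
(* The remaining sum over all labelings is at most e^mu, which is what the choice of [mu] is made
   for. *)
rewrite -mulr_sumr -mulrA ger_pMr ?expR_gt0 //.
rewrite expRN mulrC ler_pdivrMr ?expR_gt0 // mul1r.
apply: sum_expr_hamming_le; exact: expR_ge0.
Qed.

(** The term of the best alignment is bounded by the sum over all alignments, at the price of K!. *)
Lemma sum_misaligned_weight_le (R : realType) (n K : nat) (s0 : labeling n K) (x : R) :
  0 <= x -> n%:R * K%:R * x <= 1 / 2 ->
  \sum_(s : labeling n K) (misaligned s0 s)%:R * x ^+ misaligned s0 s <=
  K`!%:R * (2 * n%:R ^+ 2 * K%:R * x).
Proof.
move=> x0 small.
apply: (@le_trans _ _ (\sum_(s : labeling n K) \sum_(pi : 'S_K)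
    (hamming (relabel pi s0) s)%:R * x ^+ hamming (relabel pi s0) s)).
  apply: ler_sum => s _; have [pi ->] := misaligned_attained s0 s.
  rewrite (bigD1 pi) //=; apply: ler_wpDr => //; apply: sumr_ge0 => rho _.
  by rewrite mulr_ge0 ?exprn_ge0.
rewrite exchange_big /=.
apply: (@le_trans _ _ (\sum_(pi : 'S_K) 2 * n%:R ^+ 2 * K%:R * x)).
  by apply: ler_sum => pi _; exact: sum_hamming_weight_le.
by rewrite sumr_const card_Sn -[leLHS]mulr_natl.
Qed.

(** * The Gibbs law *)

Lemma sum_balanced_exp_gt0 (R : realType) (n K : nat) (s0 : labeling n K)
    (f : labeling n K -> R) :
  balanced s0 -> 0 < \sum_(t : labeling n K | balanced t) expR (f t).
Proof.
move=> b0; rewrite (bigD1 s0) //=; apply: ltr_wpDr; last exact: expR_gt0.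
by apply: sumr_ge0 => t _; exact: expR_ge0.
Qed.

Lemma gibbs_ge0 (R : realType) (n K : nat) (A : 'M[bool]_n) (D lambda eta : R)
    (s : labeling n K) : 0 <= gibbs A D lambda eta s.
Proof.
rewrite /gibbs; case: ifP => // _; rewrite divr_ge0 ?expR_ge0 //.
by apply: sumr_ge0 => t _; exact: expR_ge0.
Qed.

Lemma gibbs_sum1 (R : realType) (n K : nat) (A : 'M[bool]_n) (D lambda eta : R)
    (s0 : labeling n K) :
  balanced s0 -> \sum_(s : labeling n K) gibbs A D lambda eta s = 1.
Proof.
move=> b0; rewrite /gibbs -big_mkcond /= -mulr_suml divff //.
by rewrite gt_eqF // (sum_balanced_exp_gt0 _ b0).
Qed.

Lemma gibbs_le (R : realType) (n K : nat) (A : 'M[bool]_n) (D lambda eta : R)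
    (s0 s : labeling n K) :
  balanced s0 -> balanced s ->
  gibbs A D lambda eta s <=
  expR (eta * (score A D lambda s - score A D lambda s0)).
Proof.
move=> b0 bs; rewrite /gibbs bs [in leRHS]mulrBr [in leRHS]expRD [in leRHS]expRN.
apply: ler_wpM2l; first exact: expR_ge0.
rewrite lef_pV2 ?posrE ?expR_gt0 ?(sum_balanced_exp_gt0 _ b0) //.
rewrite (bigD1 s0) //= lerDl; apply: sumr_ge0 => t _; exact: expR_ge0.
Qed.

(** Labelings within [M] contribute at most [M]. For the others the partition function is bounded
    below by its term at [s0]. *)
Lemma gibbs_misaligned_le (R : realType) (n K : nat) (A : 'M[bool]_n)
    (D lambda eta delta M : R) (s0 : labeling n K) :
  balanced s0 -> 0 <= eta -> 0 <= M ->
  (forall s : labeling n K, balanced s -> M < (misaligned s0 s)%:R ->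
     score A D lambda s - score A D lambda s0 <= - (delta * (misaligned s0 s)%:R)) ->
  \sum_(s : labeling n K) gibbs A D lambda eta s * (misaligned s0 s)%:R <=
  M + \sum_(s : labeling n K) (misaligned s0 s)%:R *
        expR (- (eta * delta)) ^+ misaligned s0 s.
Proof.
move=> b0 eta0 M0 sep.
have -> : M = \sum_(s : labeling n K) gibbs A D lambda eta s * M.
  by rewrite -mulr_suml (gibbs_sum1 _ _ _ _ b0) mul1r.
rewrite -big_split /=.
apply: ler_sum => s _; set m : R := (misaligned s0 s)%:R.
have g0 := gibbs_ge0 A D lambda eta s.
have m0 : 0 <= m by rewrite ler0n.
have [mM|Mm] := leP m M.
  by apply: ler_wpDr; rewrite ?mulr_ge0 ?exprn_ge0 ?expR_ge0 // ler_wpM2l.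
apply: ler_wpDl; first exact: mulr_ge0.
rewrite mulrC; apply: ler_wpM2l => //.
case: (boolP (balanced s)) => bs; last first.
  by rewrite /gibbs (negbTE bs) exprn_ge0 ?expR_ge0.
apply: le_trans (gibbs_le _ _ _ _ b0 bs) _; rewrite -expRM_natl ler_expR -/m.
by have := sep s bs Mm; rewrite -/m; nra.
Qed.

(** * The rejection sampler *)

Lemma hammingC (n K : nat) (s t : labeling n K) : hamming s t = hamming t s.
Proof. by apply: eq_card => i; rewrite !inE eq_sym. Qed.

Lemma hamming_eq0 (n K : nat) (s t : labeling n K) : hamming s t = 0%N -> s = t.
Proof.
move=> /card0_eq h; apply/ffunP => i; have := h i.
by rewrite !inE => /negbFE/eqP.
Qed.

Lemma hamming_id (n K : nat) (s : labeling n K) : hamming s s = 0%N.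
Proof. by apply: eq_card0 => i; rewrite !inE eqxx. Qed.

(** The identity aligns [s] with itself at distance 0, so every optimal alignment returns [s]. Hence
    the center of the proposal law is never rejected. *)
Lemma canonical_reps_self (n K : nat) (s : labeling n K) :
  balanced s -> canonical_reps s s.
Proof.
move=> bs; rewrite /canonical_reps bs /=; apply/eqP; rewrite /canonical.
case: arg_minnP => //= pi0 _ min0.
case: Order.TotalTheory.arg_minP => [|pi /forallP/(_ 1%g) + _].
  by apply/forallP => pi'; exact: min0.
by rewrite relabel1 hamming_id leqn0 => /eqP/hamming_eq0.
Qed.

Lemma proposalE (R : realType) (n K : nat) (kappa : R) (t s : labeling n K) :
  proposal kappa t s =
  expR (- kappa) ^+ hamming t s / (1 + (K%:R - 1) * expR (- kappa)) ^+ n.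
Proof.
rewrite /proposal big_split /= prodr_const card_ord exprVn; congr (_ / _).
rewrite /hamming -prodr_const [RHS]big_mkcond /=; apply: eq_bigr => i _.
by rewrite inE eq_sym; case: eqP.
Qed.

(** The geometric series gives the one-trial law divided by its mass [p]. The center alone is
    accepted with probability 1/Z, so p >= 1/Z, and this cancels the normalization Z of the proposal
    whatever the other acceptance probabilities are. *)
Lemma first_accepted_law (R : realType) (n K : nat) (A : 'M[bool]_n)
    (D lambda eta kappa : R) (t : labeling n K) :
  (0 < K)%N -> balanced t ->
  [/\ forall s, 0 <= first_accepted A D lambda eta kappa t s,
      \sum_s first_accepted A D lambda eta kappa t s = 1 &
      forall s, first_accepted A D lambda eta kappa t s <=
                expR (- kappa) ^+ hamming t s].
Proof.
move=> K0 bt; pose Z := (1 + (K%:R - 1) * expR (- kappa)) ^+ n.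
have Z0 : 0 < Z.
  rewrite exprn_gt0 //; apply: ltr_wpDr => //.
  by rewrite mulr_ge0 ?expR_ge0 // subr_ge0 ler1n.
pose ta s := trial_accept A D lambda eta kappa t s.
have prop0 s : 0 <= proposal kappa t s.
  rewrite proposalE; apply: divr_ge0; last exact: ltW.
  by rewrite exprn_ge0 ?expR_ge0.
have ta0 s : 0 <= ta s.
  rewrite /ta /trial_accept; case: ifP => // _; exact: mulr_ge0.
have tale s : ta s <= proposal kappa t s.
  rewrite /ta /trial_accept; case: ifP => // _; exact: ler_piMr.
have tat : ta t = Z^-1.
  rewrite /ta /trial_accept bt canonical_reps_self //= proposalE hamming_id expr0 mul1r.
  by rewrite subrr !mulr0 addr0 expR0 minxx mulr1.
pose p := \sum_s ta s.
have tap s : ta s <= p.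
  by rewrite /p (bigD1 s) //= lerDl; exact: sumr_ge0.
have p0 : 0 < p by apply: lt_le_trans (tap t); rewrite tat invr_gt0.
have p1 : p <= 1.
  apply: (@le_trans _ _ (\sum_s proposal kappa t s)); first exact: ler_sum.
  under eq_bigr do rewrite proposalE.
  by rewrite -mulr_suml sum_expr_hamming divff // gt_eqF.
have faE s : first_accepted A D lambda eta kappa t s = ta s / p.
  rewrite /first_accepted -/p.
  have -> : (fun k : nat => (1 - p) ^+ k * trial_accept A D lambda eta kappa t s) =
      geometric (ta s) (1 - p).
    by apply: funext => k; rewrite /geometric /= mulrC.
  have -> : ta s / p = ta s / (1 - (1 - p)) by rewrite subKr.
  apply/cvg_lim => //; apply: cvg_geometric_series.
  by rewrite ger0_norm ?subr_ge0 // gtrBl.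
split=> [s||s].
- by rewrite faE divr_ge0 // ltW.
- under eq_bigr do rewrite faE.
  by rewrite -mulr_suml divff // gt_eqF.
- rewrite faE ler_pdivrMr //; apply: le_trans (tale s) _; rewrite proposalE -/Z.
  by apply: ler_wpM2l; rewrite ?exprn_ge0 ?expR_ge0 // -tat.
Qed.

Lemma rejection_sampler_sum (R : realType) (n K : nat) (A : 'M[bool]_n)
    (D lambda eta kappa : R) (t : labeling n K) (f : labeling n K -> R) :
  \sum_s rejection_sampler A D lambda eta kappa t s * f s =
  \sum_(pi : 'S_K) (K`!%:R)^-1 *
    \sum_s first_accepted A D lambda eta kappa t s * f (relabel pi s).
Proof.
rewrite /rejection_sampler; under eq_bigr do rewrite mulr_suml.
rewrite exchange_big /=; apply: eq_bigr => pi _.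
under eq_bigr do rewrite -mulrA.
rewrite -mulr_sumr; congr (_ * _).
under [LHS]eq_bigr do rewrite mulr_suml.
rewrite (exchange_big_dep xpredT) //=; apply: eq_bigr => s _.
rewrite (big_pred1 (relabel pi s)) // => u /=; exact: eq_sym.
Qed.

Lemma rejection_sampler_le (R : realType) (n K : nat) (A : 'M[bool]_n)
    (D lambda eta kappa : R) (t : labeling n K) (f : labeling n K -> R) (c : R) :
  (forall pi : 'S_K,
    \sum_s first_accepted A D lambda eta kappa t s * f (relabel pi s) <= c) ->
  \sum_s rejection_sampler A D lambda eta kappa t s * f s <= c.
Proof.
move=> fc; rewrite rejection_sampler_sum.
apply: (@le_trans _ _ (\sum_(pi : 'S_K) (K`!%:R)^-1 * c)).
  by apply: ler_sum => pi _; apply: ler_wpM2l; rewrite ?invr_ge0.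
rewrite sumr_const card_Sn -[leLHS]mulr_natl mulrA divff ?mul1r //.
Qed.

Lemma rejection_misaligned_le (R : realType) (n K : nat) (A : 'M[bool]_n)
    (D lambda eta kappa : R) (s0 t : labeling n K) :
  (0 < K)%N -> balanced t ->
  \sum_s rejection_sampler A D lambda eta kappa t s * (misaligned s0 s)%:R <=
  (misaligned s0 t)%:R +
  \sum_(s : labeling n K) (hamming t s)%:R * expR (- kappa) ^+ hamming t s.
Proof.
move=> K0 bt.
have [fa0 fa1 fale] := first_accepted_law A D lambda eta kappa K0 bt.
apply: rejection_sampler_le => pi.
have -> : (misaligned s0 t)%:R =
    \sum_s first_accepted A D lambda eta kappa t s * (misaligned s0 t)%:R.
  by rewrite -mulr_suml fa1 mul1r.
rewrite -big_split /=.
apply: ler_sum => s _.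
apply: (@le_trans _ _ (first_accepted A D lambda eta kappa t s *
    ((misaligned s0 t)%:R + (hamming t s)%:R))).
  apply: ler_wpM2l => //; rewrite -natrD ler_nat.
  by rewrite (leq_trans (misaligned_relabelr _ _ _)) // hammingC misaligned_triangle.
rewrite mulrDr lerD2l mulrC; exact: ler_wpM2l.
Qed.

(** * The certificate *)

Lemma cluster_mx_psd (R : realType) (n K : nat) (s : labeling n K) :
  psd (cluster_mx R s).
Proof.
split; first by apply/matrixP => i j; rewrite mxE cluster_mx_sym.
move=> v.
have -> : (v *m cluster_mx R s *m v^T) 0 0 =
    \sum_k (\sum_(i < n) v 0 i * (s i == k)%:R) ^+ 2.
  rewrite mxE; under eq_bigr do rewrite !mxE mulr_suml.
  under [RHS]eq_bigr do rewrite expr2 mulr_suml.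
  rewrite exchange_big [RHS]exchange_big /=; apply: eq_bigr => i _.
  under [RHS]eq_bigr do rewrite mulr_sumr.
  rewrite [RHS]exchange_big /=; apply: eq_bigr => j _.
  rewrite mxE (bigD1 (s i)) //= eqxx big1; last first.
    by move=> k /negbTE ne; rewrite eq_sym ne mulr0 mul0r.
  by rewrite addr0 mulr1 eq_sym; ring.
by apply: sumr_ge0 => k _; exact: sqr_ge0.
Qed.

Lemma cluster_mx_certificate_set (R : realType) (n K : nat) (s : labeling n K) :
  balanced s -> certificate_set K (cluster_mx R s).
Proof.
move=> bs; split.
- exact: cluster_mx_psd.
- exact: cluster_mx_diag.
- exact: cluster_mx_ge0.
- by move=> i; exact: cluster_mx_row.
Qed.

(** Makes the supremum in [certificate_value] a true upper bound. The entries of [Y] are nonnegative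
    with fixed total, which controls every term. *)
Lemma certificate_values_bounded (R : realType) (n K : nat) (A : 'M[bool]_n)
    (D lambda theta : R) (t : labeling n K) :
  balanced t -> 0 <= D -> 0 <= theta ->
  has_ubound [set Psi A D lambda Y +
    theta / n%:R * \sum_i \sum_j `|Y i j - cluster_mx R t i j| | Y in certificate_set K].
Proof.
move=> bt D0 th0; pose S : R := n%:R * (n %/ K)%:R.
exists (S + `|lambda| * S + theta / n%:R * (S + S)).
move=> _ [Y [_ _ Y0 Yrow] <-].
have sumY : \sum_i \sum_j Y i j = S.
  under eq_bigr do rewrite Yrow.
  by rewrite sumr_const card_ord /S mulr_natl.
have sumZ : \sum_i \sum_j cluster_mx R t i j = S.
  under eq_bigr do rewrite (cluster_mx_row _ _ bt).
  by rewrite sumr_const card_ord /S mulr_natl.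
have lt0 : 0 <= \sum_(i < n) \sum_(j < n | (i < j)%N) Y i j.
  by apply: sumr_ge0 => i _; apply: sumr_ge0.
have ltS : \sum_(i < n) \sum_(j < n | (i < j)%N) Y i j <= S.
  rewrite -sumY; apply: ler_sum => i _; rewrite [leLHS]big_mkcond.
  by apply: ler_sum => j _; case: ifP.
apply: lerD; last first.
  apply: ler_wpM2l; first by rewrite divr_ge0.
  rewrite -{1}sumY -sumZ -big_split /=; apply: ler_sum => i _.
  rewrite -big_split /=; apply: ler_sum => j _.
  apply: le_trans (ler_normB _ _) _.
  by rewrite !ger0_norm // cluster_mx_ge0.
apply: lerD.
  apply: le_trans (H_ext_le _ D0 Y0) _; apply: le_trans ltS.
  apply: ler_sum => i _; apply: ler_sum => j _; case: (A i j) => /=.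
    by rewrite mul1r.
  by rewrite mul0r.
apply: le_trans (ler_norm _) _; rewrite normrN normrM.
by apply: ler_wpM2l => //; rewrite ger0_norm.
Qed.

(** The cluster matrix of [s] is admissible in the certificate program, and its distance term is
    nonnegative. *)
Lemma certified_score_max (R : realType) (n K : nat) (A : 'M[bool]_n)
    (D lambda theta : R) (s t : labeling n K) :
  balanced s -> balanced t -> 0 <= D -> 0 <= theta ->
  certificate_value K A D lambda theta (cluster_mx R t) =
    Psi A D lambda (cluster_mx R t) ->
  score A D lambda s <= score A D lambda t.
Proof.
move=> bs bt D0 th0 cert; rewrite [leRHS]/score -cert.
apply: le_trans (ub_le_sup (certificate_values_bounded A lambda bt D0 th0) _); last first.
  by exists (cluster_mx R s) => //; exact: cluster_mx_certificate_set.
rewrite lerDl mulr_ge0 ?divr_ge0 //.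
by apply: sumr_ge0 => i _; exact: sumr_ge0.
Qed.

(** * Loss of the algorithm *)

Lemma loss_misaligned (R : realType) (n K : nat) (s0 s : labeling n K) :
  loss R s0 s = (misaligned s0 s)%:R / n%:R.
Proof. by []. Qed.

Lemma loss_le1 (R : realType) (n K : nat) (s0 s : labeling n K) : loss R s0 s <= 1.
Proof.
rewrite loss_misaligned; have [e|n0] := posnP n.
  by rewrite [X in _ / X](_ : _ = 0) ?invr0 ?mulr0 //; rewrite e.
by rewrite ler_pdivrMr ?ltr0n // mul1r ler_nat misaligned_le_n.
Qed.

Lemma main_algorithm_loss_le1 (R : realType) (n K : nat) (D theta eps lambda : R)
    (sstar : 'M[bool]_n -> labeling n K) (A : 'M[bool]_n) (s0 : labeling n K) :
  (0 < K)%N -> balanced (sstar A) ->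
  \sum_s main_algorithm D theta eps lambda sstar A s * loss R s0 s <= 1.
Proof.
move=> K0 bt; rewrite /main_algorithm; case: eqP => _.
  apply: rejection_sampler_le => pi.
  have [fa0 fa1 _] := first_accepted_law A D lambda (eps / (2 * D))
    (2 * (eps / (2 * D)) * theta / K%:R) K0 bt.
  rewrite -[leRHS]fa1; apply: ler_sum => s _.
  by apply: ler_piMr => //; exact: loss_le1.
rewrite -[leRHS](gibbs_sum1 A D lambda (eps / (2 * D)) bt); apply: ler_sum => s _.
by apply: ler_piMr; [exact: gibbs_ge0 | exact: loss_le1].
Qed.

(** Deterministic bound for a separated graph; [x] dominates the weight per misaligned vertex in
    both branches. *)
Lemma main_algorithm_loss_le (R : realType) (n K : nat)
    (D theta eps lambda delta mu x : R)
    (sstar : 'M[bool]_n -> labeling n K) (A : 'M[bool]_n) (s0 : labeling n K) :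
  let eta := eps / (2 * D) in
  (0 < n)%N -> (0 < K)%N -> balanced s0 -> balanced (sstar A) ->
  0 < D -> 0 <= theta -> 0 <= eps -> 0 < delta -> 0 <= mu ->
  separated s0 delta mu A ->
  expR (- (eta * (delta / 2))) <= x -> expR (- (2 * eta * theta / K%:R)) <= x ->
  n%:R * K%:R * x <= 1 / 2 ->
  \sum_s main_algorithm D theta eps lambda sstar A s * loss R s0 s <=
  (mu + 2 / delta * excess A D s0) / n%:R + K`!%:R * (2 * n%:R * K%:R * x).
Proof.
move=> eta n0 K0 b0 bt D0 th0 eps0 delta0 mu0 sep x1 x2 small.
have X0 := excess_ge0 A D s0; set X := excess A D s0 in X0 *.
(* Beyond [M] the truncation term is at most half of the drop in inner edges, leaving the rate delta
   / 2. *)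
set M := mu + _.
have M0 : 0 <= M by rewrite addr_ge0 // mulr_ge0 ?divr_ge0 // ltW.
have n0R : 0 < n%:R :> R by rewrite ltr0n.
have eta0 : 0 <= eta by rewrite divr_ge0 ?mulr_ge0 // ltW.
have far (s : labeling n K) : balanced s -> M < (misaligned s0 s)%:R ->
    score A D lambda s - score A D lambda s0 <= - (delta / 2 * (misaligned s0 s)%:R).
  move=> bs Mm; apply: le_trans (score_sub_le A lambda (ltW D0) b0 bs) _; rewrite -/X.
  have m0 : (0 < misaligned s0 s)%N by rewrite -(ltr0n R) (le_lt_trans M0).
  have dX : 0 <= 2 / delta * X by rewrite mulr_ge0 ?divr_ge0 // ltW.
  have := sep s bs m0; have -> : mu <= (misaligned s0 s)%:R.
    by apply: ltW; apply: le_lt_trans Mm; rewrite /M lerDl.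
  move=> /(_ isT).
  have : X <= delta / 2 * (misaligned s0 s)%:R.
    have -> : X = delta / 2 * (2 / delta * X) by field; rewrite gt_eqF.
    apply: ler_wpM2l; first by rewrite divr_ge0 // ltW.
    by apply: ltW; apply: le_lt_trans Mm; rewrite /M lerDr.
  lra.
have x0 y : expR y <= x -> 0 <= x by apply/le_trans/expR_ge0.
have small' y : expR y <= x -> n%:R * K%:R * expR y <= 1 / 2.
  by move=> yx; apply: le_trans small; apply: ler_wpM2l => //; rewrite mulr_ge0.
have K1 : 1 <= K`!%:R :> R by rewrite ler1n fact_gt0.
have scale y : expR y <= x ->
    2 * n%:R ^+ 2 * K%:R * expR y <= 2 * n%:R ^+ 2 * K%:R * x.
  by move=> yx; apply: ler_wpM2l => //; rewrite !mulr_ge0 ?exprn_ge0.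
have B0 : 0 <= 2 * n%:R ^+ 2 * K%:R * x.
  by rewrite !mulr_ge0 ?exprn_ge0 ?(x0 _ x1).
suff le : \sum_s main_algorithm D theta eps lambda sstar A s * (misaligned s0 s)%:R <=
    M + K`!%:R * (2 * n%:R ^+ 2 * K%:R * x).
  have -> : \sum_s main_algorithm D theta eps lambda sstar A s * loss R s0 s =
      (\sum_s main_algorithm D theta eps lambda sstar A s * (misaligned s0 s)%:R) / n%:R.
    by rewrite mulr_suml; apply: eq_bigr => s _; rewrite loss_misaligned mulrA.
  have -> : M / n%:R + K`!%:R * (2 * n%:R * K%:R * x) =
      (M + K`!%:R * (2 * n%:R ^+ 2 * K%:R * x)) / n%:R.
    by field; rewrite gt_eqF.
  by apply: ler_wpM2r => //; rewrite invr_ge0 ltW.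
rewrite /main_algorithm -/eta; case: eqP => [cert|_].
  apply: le_trans (rejection_misaligned_le _ _ _ _ _ _ K0 bt) _.
  apply: lerD.
    (* A certified labeling farther than [M] would score below [s0], contradicting its
       maximality. *)
    rewrite leNgt; apply/negP => Mm.
    have := far _ bt Mm; have := certified_score_max b0 bt (ltW D0) th0 cert.
    have := mulr_gt0 delta0 (le_lt_trans M0 Mm); lra.
  apply: le_trans (sum_hamming_weight_le _ (expR_ge0 _) (small' _ x2)) _.
  apply: le_trans (scale _ x2) _; exact: ler_peMl.
apply: le_trans (gibbs_misaligned_le b0 eta0 M0 far) _; rewrite lerD2l.
apply: le_trans (sum_misaligned_weight_le _ (expR_ge0 _) (small' _ x1)) _.
by apply: ler_wpM2l; [exact: le_trans K1 | exact: scale].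
Qed.

(** On every graph the loss is at most the indicator of non-separation plus the deterministic bound;
    the terms are then averaged separately. *)
Lemma expected_loss_le (R : realType) (n K : nat)
    (a b v D theta eps lambda x : R)
    (sstar : 'M[bool]_n -> labeling n K) (s0 : labeling n K) :
  let r := (1 - v) ^+ 2 / 16 * (a / K%:R) in
  let delta := 2 * r / - ln v in
  let eta := eps / (2 * D) in
  (0 < n)%N -> (K %| n)%N -> balanced s0 ->
  (forall A, is_graph A -> balanced (sstar A)) ->
  0 < v < 1 -> 0 <= b -> b <= v ^+ 2 * a -> a <= n%:R -> 1 <= r ->
  expR 2 * (a / K%:R) <= D -> 0 <= theta -> 0 <= eps ->
  expR (- (eta * (delta / 2))) <= x -> expR (- (2 * eta * theta / K%:R)) <= x ->
  n%:R * K%:R * x <= 1 / 2 ->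
  expected_loss a b (main_algorithm D theta eps lambda sstar) s0 <=
  expR (1 - r) + K%:R * expR (- r) + 2 / delta * expR (- (a / K%:R)) +
  K`!%:R * (2 * n%:R * K%:R * x).
Proof.
move=> r delta eta n0 Kn b0 bt v01 bb0 bv an r1 aD th0 eps0 x1 x2 small.
have /andP[v0 v1] := v01.
have n0R : 0 < n%:R :> R by rewrite ltr0n.
have K0 : (0 < K)%N by rewrite (dvdn_gt0 n0).
have K0R : 0 < K%:R :> R by rewrite ltr0n.
have a0 : 0 < a.
  have : 0 < r := lt_le_trans ltr01 r1.
  have h : 0 < (1 - v) ^+ 2 / 16 by rewrite divr_gt0 // exprn_gt0 // subr_gt0.
  by rewrite /r pmulr_rgt0 // pmulr_lgt0 ?invr_gt0.
have ba : b <= a.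
  apply: le_trans bv _; apply: ler_piMl; first exact: ltW.
  by rewrite expr_le1 // ltW.
have p01 i j : 0 <= edge_prob a b s0 i j <= 1.
  rewrite /edge_prob; case: ifP => _; rewrite divr_ge0 ?ler_pdivrMr ?mul1r ?(ltW a0) //=.
  exact: le_trans an.
have u0 : 0 < - ln v by rewrite oppr_gt0 ln_lt0 ?v0.
have delta0 : 0 < delta by rewrite divr_gt0 // mulr_gt0 // (lt_le_trans ltr01).
have D0 : 0 < D.
  by apply: lt_le_trans aD; rewrite mulr_gt0 ?expR_gt0 ?divr_gt0.
have w0 : 0 <= 2 / delta / n%:R.
  apply: divr_ge0; last exact: ltW.
  by apply: divr_ge0; last exact: ltW.
set mu := n%:R * K%:R * expR (- r).
have mu0 : 0 <= mu by rewrite !mulr_ge0 ?expR_ge0.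
set Q := K`!%:R * _.
have Q0 : 0 <= Q.
  by rewrite !mulr_ge0 //; apply: le_trans x1; exact: expR_ge0.
apply: (@le_trans _ _ (sbm_mean a b s0 (fun A =>
   (~~ `[< separated s0 delta mu A >])%:R +
   ((mu / n%:R + Q) + 2 / delta / n%:R * excess A D s0)))).
  apply: sbm_mean_le => // A gA; have btA := bt A gA.
  have ex0 : 0 <= 2 / delta / n%:R * excess A D s0.
    by apply: mulr_ge0; last exact: excess_ge0.
  have mun : 0 <= mu / n%:R by rewrite divr_ge0.
  case: asboolP => [sep|_] /=.
    rewrite add0r; apply: le_trans (main_algorithm_loss_le _ n0 K0 b0 btA D0 th0
      eps0 delta0 mu0 sep x1 x2 small) _.
    by rewrite -/Q le_eqVlt; apply/orP; left; apply/eqP; field; rewrite !gt_eqF.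
  apply: le_trans (main_algorithm_loss_le1 _ _ _ _ _ K0 btA) _; lra.
rewrite sbm_meanD sbm_meanD sbm_mean_cst sbm_meanZ.
have h1 := mean_not_separated_le Kn n0 p01 b0 (ltW a0) v01 bv r1.
have h2 := mean_excess_le Kn n0 p01 b0 (ltW a0) aD.
have h3 : mu / n%:R = K%:R * expR (- r) by rewrite /mu; field; rewrite gt_eqF.
have h4 : 2 / delta / n%:R * sbm_mean a b s0 (fun A => excess A D s0) <=
    2 / delta * expR (- (a / K%:R)).
  have -> : 2 / delta * expR (- (a / K%:R)) =
     2 / delta / n%:R * (n%:R * expR (- (a / K%:R))).
    by field; rewrite !gt_eqF.
  exact: ler_wpM2l.
move: h1 h4; rewrite -/mu h3; lra.
Qed.

(** * Size estimates and the choice of constants *)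

Lemma ln2_ge_half (R : realType) : 1 / 2 <= ln 2 :> R.
Proof.
rewrite -ler_expR lnK ?posrE //.
have := expR_ge1Dx (- (1 / 2) : R); rewrite expRN => h.
have p : 0 < expR (1 / 2) :> R := expR_gt0 _.
rewrite -[leLHS]invrK -[leRHS]invrK lef_pV2 ?posrE ?invr_gt0 //; lra.
Qed.

(** As ln K >= 1/2, K grows at most linearly in y = ln n, while e^(dl y) >= (dl y / 2)^2. The
    threshold makes this square dominate and forces y >= 1. *)
Lemma addn_le_power (R : realType) (dl C Cm : R) : 0 < dl -> 0 <= C -> 0 <= Cm ->
  exists Y : R, forall n K : nat, (2 <= K)%N -> K%:R * ln K%:R <= Cm * ln n%:R ->
    Y <= ln n%:R -> K%:R + C <= expR (dl * ln n%:R).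
Proof.
move=> dl0 C0 Cm0; exists (1 + 4 * (2 * Cm + C) / dl ^+ 2) => n K K2 Kln Yn.
set y := ln n%:R in Kln Yn *.
have K1 : 1 / 2 <= ln K%:R :> R.
  by apply: le_trans (ln2_ge_half R) _; rewrite ler_ln ?posrE ?ltr0n ?ler_nat // ltnW.
have KR : 0 <= K%:R :> R by [].
have Kle : K%:R <= 2 * Cm * y by nra.
have q0 : 0 <= 4 * (2 * Cm + C) / dl ^+ 2.
  by rewrite divr_ge0 ?exprn_ge0 ?(ltW dl0) // mulr_ge0 // addr_ge0 // mulr_ge0.
have y1 : 1 <= y by lra.
have yq : 4 * (2 * Cm + C) <= dl ^+ 2 * y.
  rewrite [leRHS]mulrC -ler_pdivrMr ?exprn_gt0 //; lra.
have -> : dl * y = dl * y / 2 + dl * y / 2 by field.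
rewrite expRD.
have h : 1 + dl * y / 2 <= expR (dl * y / 2) := expR_ge1Dx _.
have d0 : 0 <= dl * y / 2 by rewrite divr_ge0 // mulr_ge0 ?(ltW dl0) //; lra.
apply: (@le_trans _ _ ((dl * y / 2) * (dl * y / 2))); last first.
  by apply: ler_pM => //; lra.
have -> : dl * y / 2 * (dl * y / 2) = dl ^+ 2 * y * y / 4 by field.
nra.
Qed.

(** K! <= K^K = exp(K ln K), so the number of alignments is a fixed power of [n]. *)
Lemma fact_le_power (R : realType) (n K : nat) (Cm : R) : (0 < K)%N ->
  K%:R * ln K%:R <= Cm * ln n%:R -> K`!%:R <= expR (Cm * ln n%:R).
Proof.
move=> K0 h; apply: le_trans (_ : expR (K%:R * ln K%:R) <= _); last by rewrite ler_expR.
rewrite expRM_natl lnK ?posrE ?ltr0n // -natrX ler_nat.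
elim: {1 3 5}K (leqnn K) => [//|k IH] kK; rewrite ?expn0 // factS expnS.
by apply: leq_mul => //; apply: IH; exact: ltnW.
Qed.

Theorem theorem2 (R : realType) (rho_plus : R)
  (rho_plus_gt0 : 0 < rho_plus) (rho_plus_lt1 : rho_plus < 1) :
  exists C0 chi0 : R, 0 < C0 /\ 0 < chi0 /\
  forall C_deg chi : R, C0 <= C_deg -> 0 < chi -> chi <= chi0 ->
  forall C_mg rho_minus : R, 0 < C_mg ->
    0 < rho_minus -> rho_minus <= rho_plus ->
  exists L c1 c2 c3 : R, 0 < L /\ 0 < c1 /\ 0 < c2 /\ 0 < c3 /\
  forall A0 : R, 0 < A0 ->
  forall (n K : nat -> nat) (a b : nat -> R),
    n t @[t --> \oo] --> \oo ->
    (forall t, (0 < n t)%N /\ (2 <= K t)%N /\ (K t %| n t)%N) ->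
    (* Assumption 1 *)
    (forall t, (K t)%:R * ln ((K t)%:R : R) <= C_mg * ln (n t)%:R) ->
    (* Assumption 2 *)
    (forall t, A0 * ln (n t * K t)%N%:R <= a t / (K t)%:R) ->
    a t / (n t)%:R @[t --> \oo] --> (0 : R) ->
    b t / (n t)%:R @[t --> \oo] --> (0 : R) ->
    (forall t, rho_minus <= b t / a t /\ b t / a t <= rho_plus) ->
  \forall t \near \oo,
  forall (eps lambda : R)
    (Xhat : 'M[bool]_(n t) -> 'M[R]_(n t))
    (sstar : 'M[bool]_(n t) -> labeling (n t) (K t)),
    candidate_choice Xhat sstar ->
    L * ln (n t * K t)%N%:R <= eps ->
    let D := C_deg * (a t / (K t)%:R) in
    let theta := chi * a t in
    (* the input requirement of the Main Algorithm on kappa is met *)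
    ln (4 * (n t)%:R * ((K t)%:R - 1)) <=
      2 * (eps / (2 * D)) * theta / (K t)%:R /\
    sup [set expected_loss (a t) (b t)
               (main_algorithm D theta eps lambda sstar) sigma0
        | sigma0 in [set sigma | balanced sigma]]
    <= expR (- (c1 * ((n t)%:R * renyi_half (n t) (a t) (b t) / (K t)%:R)))
       + (n t * K t)%N%:R^-1 * expR (- (c2 * eps))
       + (n t * K t)%N%:R `^ (- (c3 * A0)).
Proof.
(* So that b <= v^2 a, as [mean_drift_le] asks. *)
pose v := Num.sqrt rho_plus.
have v0 : 0 < v by rewrite sqrtr_gt0.
have v2 : v ^+ 2 = rho_plus by rewrite sqr_sqrtr // ltW.
have v1 : v < 1 by rewrite -(@ltr_pXn2r _ 2) ?nnegrE ?(ltW v0) // v2 expr1n.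
pose u := - ln v.
have u0 : 0 < u by rewrite oppr_gt0 ln_lt0 ?v0.
pose g := (1 - v) ^+ 2 / 16.
have g0 : 0 < g by rewrite divr_gt0 // exprn_gt0 // subr_gt0.
have g1 : g <= 1 by rewrite /g; nra.
(* [expR 2] is the truncation threshold of [mean_excess_le]. *)
exists (expR 2), 1; split; first exact: expR_gt0.
split=> // C_deg chi Cdeg chi0 _ C_mg rho_minus Cmg0 rm0 _.
have C0 : 0 < C_deg := lt_le_trans (expR_gt0 _) Cdeg.
pose c5 := g / (2 * C_deg * u).
have c50 : 0 < c5 by rewrite divr_gt0 // !mulr_gt0.
(* The Gibbs weight decays at rate [c5] in eps, the proposal weight at rate chi / C_deg. Half of the
   smaller rate is kept; the other half absorbs prefactors. *)
pose c2 := Num.min c5 (chi / C_deg) / 2.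
have c20 : 0 < c2 by rewrite divr_gt0 // lt_min c50 divr_gt0.
have c2le5 : 2 * c2 <= c5 by rewrite /c2 mulrC divfK // ge_min lexx.
have c2lechi : 2 * c2 <= chi / C_deg by rewrite /c2 mulrC divfK // ge_min lexx orbT.
(* With l = ln (nK), the term C_mg l pays for K!, 2 l for the factor 2nK, and the last l yields
   1/(nK). *)
pose L := (C_mg + 3) / c2.
have L0 : 0 < L by rewrite divr_gt0 // addr_gt0.
exists L, 1, c2, (g / 2); do ![split=> //]; first by rewrite divr_gt0.
move=> A0 A00 n K a b ninf nK as1 as2 an0 _ rho.
have [Y hY] : exists Y : R, forall n K : nat, (2 <= K)%N ->
    K%:R * ln K%:R <= C_mg * ln n%:R -> Y <= ln n%:R ->
    K%:R + (expR 1 + u / g) <= expR (g / 2 * A0 * ln n%:R).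
  apply: addn_le_power; last exact: ltW.
    by rewrite mulr_gt0 // divr_gt0.
  by apply: addr_ge0; [exact: expR_ge0 | apply: divr_ge0; exact: ltW].
(* [Y] serves [addn_le_power]; the other bound ensures r >= 1. *)
pose M := Num.max Y (1 / (g * A0)).
near=> t.
have [n0 [K2 Kn]] := nK t.
have K0 : (0 < K t)%N := ltnW K2.
have n0R : 0 < (n t)%:R :> R by rewrite ltr0n.
have K0R : 0 < (K t)%:R :> R by rewrite ltr0n.
have yM : M <= ln (n t)%:R.
  rewrite -ler_expR lnK ?posrE //.
  apply: (@le_trans _ _ (Num.bound (expR M))%:R).
    by apply: ltW; apply: archi_boundP; exact: expR_ge0.
  by rewrite ler_nat; near: t; move/cvgnyPge : ninf; apply.
have an : a t <= (n t)%:R.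
  rewrite -[leRHS]mul1r -ler_pdivrMr //; near: t; exact: (cvgr_le _ an0 _ ltr01).
have [rho1 rho2] := rho t; have as1t := as1 t; have as2t := as2 t.
move=> eps lambda Xhat sstar choice epsL.
pose D := C_deg * (a t / (K t)%:R); pose theta := chi * a t.
rewrite -/D -/theta.
pose l : R := ln (n t * K t)%N%:R; pose al := a t / (K t)%:R.
rewrite -/l in epsL; rewrite -/l -/al in as2t.
set y := ln (n t)%:R in yM as1t.
have lK : 1 / 2 <= ln (K t)%:R :> R.
  by apply: le_trans (ln2_ge_half R) _; rewrite ler_ln ?posrE ?ltr0n // ler_nat.
have lE : l = y + ln (K t)%:R by rewrite /l natrM lnM ?posrE.
have yl : y <= l by lra.
have [yY yg] : Y <= y /\ 1 / (g * A0) <= y.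
  by move: yM; rewrite /M ge_max => /andP[].
have gA0 : 0 < g * A0 by rewrite mulr_gt0.
have gAy : 1 <= g * A0 * y by rewrite mulrC -ler_pdivrMr.
have y0 : 0 < y by rewrite -(pmulr_rgt0 _ gA0); apply: lt_le_trans gAy.
pose r := g * al.
have rl : g * A0 * l <= r by rewrite -mulrA ler_pM2l.
have r1 : 1 <= r.
  by apply: le_trans gAy _; apply: le_trans rl; rewrite ler_pM2l.
have alr : r <= al.
  have : 0 < al by rewrite -(pmulr_rgt0 _ g0); apply: lt_le_trans r1.
  by move=> al0; rewrite /r ger_pMl.
have al0 : 0 < al by apply: lt_le_trans alr; apply: lt_le_trans r1.
have a0 : 0 < a t by rewrite -(@pmulr_lgt0 _ (K t)%:R^-1) ?invr_gt0.
have D0 : 0 < D by rewrite mulr_gt0.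
have c2L : c2 * L = C_mg + 3 by rewrite /L mulrC divfK ?gt_eqF.
have epsl : (C_mg + 3) * l <= c2 * eps by rewrite -c2L -mulrA ler_pM2l.
have l0 : 0 < l by lra.
have l3 : 3 * l <= c2 * eps.
  by apply: le_trans epsl; rewrite ler_pM2r // lerDr ltW.
have eps0 : 0 < eps by apply: lt_le_trans epsL; rewrite mulr_gt0.
have nK4 : (4 <= n t * K t)%N.
  by apply: (@leq_mul 2 2) => //; apply: leq_trans K2 _; rewrite dvdn_leq.
have nKR : 0 < (n t * K t)%N%:R :> R by rewrite ltr0n (leq_trans _ nK4).
have el : expR l = (n t)%:R * (K t)%:R by rewrite /l lnK ?posrE // natrM.
have kappaE : 2 * (eps / (2 * D)) * theta / (K t)%:R = eps * (chi / C_deg).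
  by rewrite /D /theta /al; field; rewrite !gt_eqF.
have kappa_ge : 2 * (c2 * eps) <= eps * (chi / C_deg).
  by rewrite mulrA [leRHS]mulrC ler_pM2r.
split.
  (* Since nK >= 4, the quantity 4n(K - 1) is at most (nK)^2. *)
  rewrite kappaE; apply: (@le_trans _ _ (l *+ 2)).
    rewrite -lnXn // ler_ln ?posrE ?exprn_gt0 //; last first.
      by rewrite !mulr_gt0 // subr_gt0 ltr1n.
    apply: (@le_trans _ _ (4 * (n t * K t)%N%:R)).
      by rewrite natrM -mulrA ler_pM2l // ler_pM2l // gerBl.
    by rewrite expr2 ler_pM2r // ler_nat.
  rewrite -mulr_natr; lra.
pose x := expR (- (2 * (c2 * eps))).
have small : (n t)%:R * (K t)%:R * x <= 1 / 2.
  rewrite -el -expRD; apply: (@le_trans _ _ (expR (- l))).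
    rewrite ler_expR; lra.
  rewrite expRN div1r lef_pV2 ?posrE ?expR_gt0 // el -natrM ler_nat.
  exact: leq_trans nK4.
have nKV : (n t * K t)%N%:R^-1 = expR (- l) :> R by rewrite expRN lnK ?posrE.
have powE : (n t * K t)%N%:R `^ (- (g / 2 * A0)) = expR (- (g / 2 * A0) * l).
  by rewrite /powR gt_eqF.
rewrite nKV powE -expRD.
set delta := 2 * r / u.
have delta_le : 2 / delta <= u / g.
  have -> : 2 / delta = u / g / al by rewrite /delta /r; field; rewrite !gt_eqF.
  rewrite ler_pdivrMr //; apply: ler_peMr; last exact: le_trans alr.
  by apply: divr_ge0; exact: ltW.
(* All three terms are multiples of e^(-r) at most. Half of r >= g A0 l absorbs the prefactor K + e
   + u / g, hence the constant g / 2. *)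
have term1 : expR (1 - r) + (K t)%:R * expR (- r) + 2 / delta * expR (- al) <=
    expR (- (g / 2 * A0) * l).
  apply: (@le_trans _ _ (((K t)%:R + (expR 1 + u / g)) * expR (- r))).
    have : 2 / delta * expR (- al) <= u / g * expR (- r).
      apply: ler_pM => //; rewrite ?expR_ge0 ?ler_expR ?lerN2 //.
      by rewrite divr_ge0 // divr_ge0 ?(ltW u0) // mulr_ge0 // (le_trans ler01).
    rewrite expRD; lra.
  apply: (@le_trans _ _ (expR (g / 2 * A0 * y) * expR (- r))).
    by apply: ler_wpM2r; [exact: expR_ge0 | exact: hY].
  rewrite -expRD ler_expR.
  have : g / 2 * A0 * y <= g / 2 * A0 * l by rewrite ler_pM2l // mulr_gt0 // divr_gt0.
  lra.
have term2 : (K t)`!%:R * (2 * (n t)%:R * (K t)%:R * x) <= expR (- l + - (c2 * eps)).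
  have fK := fact_le_power K0 as1t.
  apply: (@le_trans _ _ (expR (C_mg * l) * (expR l * (expR l * x)))).
    apply: ler_pM => //.
    - by rewrite !mulr_ge0 ?expR_ge0.
    - by apply: le_trans fK _; rewrite ler_expR ler_pM2l.
    rewrite -(mulrA 2) -(mulrA 2) -el; apply: ler_pM => //.
      by rewrite mulr_ge0 ?expR_ge0.
    by rewrite el -natrM ler_nat (leq_trans _ nK4).
  rewrite -!expRD ler_expR; lra.
set S := [set _ | _ in _].
(* The supremum of the empty set is 0 by convention. *)
have [->|/set0P S0] := eqVneq S set0.
  by rewrite sup0 !addr_ge0 ?expR_ge0.
apply: ge_sup => // _ [s0 /= bs0 <-].
have bst A : is_graph A -> balanced (sstar A) by move=> /choice[].
have b0 : 0 <= b t.
  by rewrite -(@pmulr_lge0 _ (a t)^-1) ?invr_gt0 // (le_trans _ rho1) // ltW.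
have bv : b t <= v ^+ 2 * a t by rewrite v2 -ler_pdivrMr.
have x1 : expR (- (eps / (2 * D) * (delta / 2))) <= x.
  rewrite ler_expR lerN2.
  have -> : eps / (2 * D) * (delta / 2) = c5 * eps.
    by rewrite /D /delta /r /al /c5; field; rewrite !gt_eqF.
  by rewrite mulrA ler_pM2r.
have x2 : expR (- (2 * (eps / (2 * D)) * theta / (K t)%:R)) <= x.
  by rewrite kappaE ler_expR lerN2.
have aD : expR 2 * (a t / (K t)%:R) <= D by rewrite ler_pM2r.
have theta0 : 0 <= theta by rewrite mulr_ge0 // ltW.
have := expected_loss_le (v := v) lambda n0 Kn bs0 bst _ b0 bv an r1 aD theta0
  (ltW eps0) x1 x2 small.
rewrite v0 v1 => /(_ isT) main.
apply: le_trans main _; rewrite -/g -/al -/r -/u -/delta.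
apply: (@le_trans _ _ (expR (- (g / 2 * A0) * l) + expR (- l + - (c2 * eps)))).
  exact: lerD.
rewrite addrC -addrA lerDr; exact: expR_ge0.
Unshelve. all: by end_near.
Qed.
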